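(* Let $F$ be a field of characteristic $2$. Let $\phi$ be an anisotropic quasilinear quadratic form of dimension $>1$ over $F$, and write $\dim\phi = 2^n+m$ for uniquely determined integers $n\geq 0$ and $m\in[1,2^n]$. Let $L$ be a field extension of $F$. If $i_0(\phi_L)<m$, then $i_0(\phi_L)\leq m-i_1(\phi)$.
   Context: Let $F$ be a field of characteristic $2$. A quasilinear quadratic form over $F$ is a quadratic form $\phi\colon V_\phi\to F$ on a finite-dimensional $F$-vector space with $\phi(v+w)=\phi(v)+\phi(w)$ for all $v,w$ (equivalently, in a basis, $\phi=a_1X_1^2+\dots+a_nX_n^2$ with $a_i\in F$). It is isotropic if $\phi(v)=0$ for some $v\neq0$, anisotropic otherwise. The set of $v$ with $\phi(v)=0$ is a subspace whose dimension is denoted $i_0(\phi)$ (the defect index). For a field extension $L/F$, $\phi_L$ denotes extension of scalars. If $\phi$ is anisotropic of dimension $>1$, the projective scheme $X_\phi=\{\phi=0\}\subset\mathbb P(V_\phi)$ is integral; $F(\phi)$ denotes its function field, and $i_1(\phi):=i_0(\phi_{F(\phi)})$. *)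

(* Defs.v *)
From HB Require Import structures.
From mathcomp Require Import all_boot all_order all_algebra.
From mathcomp Require Import fraction generic_quotient ring_quotient mpoly.
From mathcomp Require Import boolp.
From mathcomp Require Import ring.

Set Implicit Arguments.
Unset Strict Implicit.
Unset Printing Implicit Defensive.

Import GRing.Theory.
Local Open Scope ring_scope.

(* Over a field of characteristic 2, an anisotropic diagonal quadratic form in at
   least two variables is a prime element of the polynomial ring. *)
Section DiagonalPrime.
Variables (F : fieldType) (N : nat) (a : 'I_N -> F).

Let P : {mpoly F[N]} := \sum_i a i *: 'X_i ^+ 2.

Hypothesis aniso : forall x : 'I_N -> F,
  \sum_i a i * x i ^+ 2 = 0 -> forall i, x i = 0.
Hypothesis N_gt1 : (1 < N)%N.
Hypothesis two0 : 2%:R = 0 :> F.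

Lemma mpoly_sqrD (f g : {mpoly F[N]}) : (f + g) ^+ 2 = f ^+ 2 + g ^+ 2.
Proof.
rewrite sqrrD -[_ *+ 2]mulr_natl.
suff -> : (2%:R : {mpoly F[N]}) = 0 by rewrite mul0r addr0.
by rewrite -mpolyC_nat two0 mpolyC0.
Qed.

Lemma mcoeff_sqr (f : {mpoly F[N]}) m : (f ^+ 2)@_(m + m) = f@_m ^+ 2.
Proof.
have -> : f ^+ 2 = \sum_(k <- msupp f) (f@_k) ^+ 2 *: 'X_[k + k].
  rewrite {1}[f]mpolyE (big_morph (fun x => x ^+ 2) mpoly_sqrD (expr0n _ 2)).
  by apply: eq_bigr => k _; rewrite exprZn [X in _ *: X]expr2 -mpolyXD.
rewrite raddf_sum /=.
have E k : ((k + k)%MM == (m + m)%MM) = (k == m).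
  apply/eqP/eqP=> [/mnmP h|->//]; apply/mnmP=> i.
  by have := h i; rewrite !mnmDE !addnn => /double_inj.
under eq_bigr do rewrite mcoeffZ mcoeffX E.
case: (boolP (m \in msupp f)) => [ms|].
  rewrite (bigD1_seq m) //= ?msupp_uniq // eqxx mulr1 big1 ?addr0 //.
  by move=> k /negPf->; rewrite mulr0.
move=> mns; rewrite (memN_msupp_eq0 mns) expr0n /= big_seq big1 // => k ks.
case: eqP => [e|]; last by rewrite mulr0.
by rewrite -e ks in mns.
Qed.

Lemma mpoly_aniso (f : 'I_N -> {mpoly F[N]}) :
  \sum_i a i *: f i ^+ 2 = 0 -> forall i, f i = 0.
Proof.
move=> h i; apply/mpolyP => m; rewrite mcoeff0.
apply: (aniso (x := fun i => (f i)@_m)).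
have := congr1 (mcoeff (m + m)) h; rewrite mcoeff0 raddf_sum /= => e; rewrite -[RHS]e.
by apply: eq_bigr => j _; rewrite mcoeffZ mcoeff_sqr.
Qed.

Lemma coef_neq0 i : a i != 0.
Proof.
apply/eqP=> ai0; suff /aniso/(_ i)/eqP : \sum_j a j * (j == i)%:R ^+ 2 = 0.
  by rewrite eqxx oner_eq0.
rewrite (bigD1 i) //= ai0 mul0r add0r big1 // => j /negPf->.
by rewrite expr0n mulr0.
Qed.

Lemma mcoeffP_diag m :
  P@_m = \sum_i a i * ((U_(i) + U_(i))%MM == m)%:R.
Proof.
rewrite raddf_sum /=; apply: eq_bigr => i _.
by rewrite mcoeffZ (expr2 'X_i) -mpolyXD mcoeffX.
Qed.

Lemma diag_neq0 : P != 0.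
Proof.
have i : 'I_N by case: N N_gt1 => // n _; exact: ord0.
apply/eqP=> /(congr1 (mcoeff (U_(i) + U_(i)))) /eqP.
rewrite mcoeff0 mcoeffP_diag (bigD1 i) //= eqxx mulr1 big1 ?addr0.
  by rewrite (negPf (coef_neq0 i)).
move=> j ji; case: eqP => [/mnmP/(_ i)|]; last by rewrite mulr0.
by rewrite !mnmDE !mnmE eqxx (negPf ji).
Qed.

Lemma mlead_diag : exists k, mlead P = (U_(k) + U_(k))%MM.
Proof.
have := mlead_supp diag_neq0; rewrite mcoeff_msupp mcoeffP_diag.
case: (pickP (fun k => (U_(k) + U_(k))%MM == mlead P)) => [k /eqP e _|h].
  by exists k.
by rewrite big1 ?eqxx // => i _; rewrite h mulr0.
Qed.

Lemma ord_neq (k : 'I_N) : exists j, j != k.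
Proof.
case: N N_gt1 k => [|[|n]] // _ k; exists (if k == ord0 then ord_max else ord0).
by case: (eqVneq k ord0) => [->|]; rewrite // eq_sym.
Qed.

Definition dvd_diag (p : {mpoly F[N]}) := exists q, p = q * P.

Definition freeof (k : 'I_N) (p : {mpoly F[N]}) :=
  forall m, m \in msupp p -> m k = 0%N.

Lemma freeofD k p q : freeof k p -> freeof k q -> freeof k (p + q).
Proof.
by move=> hp hq m /msuppD_le; rewrite mem_cat => /orP[/hp|/hq].
Qed.

Lemma freeofM k p q : freeof k p -> freeof k q -> freeof k (p * q).
Proof.
move=> hp hq m /msuppM_le /allpairsP[[m1 m2] /= [/hp h1 /hq h2 ->]].
by rewrite mnmDE h1 h2.
Qed.

Lemma freeofC k c : freeof k c%:MP.
Proof.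
move=> m; rewrite msuppC; case: eqP => // _.
by rewrite inE => /eqP->; rewrite mnm0E.
Qed.

Lemma freeofX k i : i != k -> freeof k 'X_i.
Proof. by move=> ik m; rewrite msuppX inE => /eqP->; rewrite mnmE (negPf ik). Qed.

Lemma diag_prime (p q : {mpoly F[N]}) : dvd_diag (p * q) -> dvd_diag p \/ dvd_diag q.
Proof.
have [k leadP] := mlead_diag.
pose b : {mpoly F[N]} := - \sum_(i | i != k) (a i / a k) *: 'X_i ^+ 2.
have ak := coef_neq0 k.
have XkE : 'X_k ^+ 2 = b + ((a k)^-1)%:MP * P :> {mpoly F[N]}.
  have -> : P = a k *: 'X_k ^+ 2 + \sum_(i | i != k) a i *: 'X_i ^+ 2.
    by rewrite /P (bigD1 k).
  rewrite /b mul_mpolyC scalerDr scalerA mulVf // scale1r scaler_sumr addrCA.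
  under [X in _ + (_ + X)]eq_bigr do rewrite scalerA mulrC.
  by rewrite addNr addr0.
have fb : freeof k b.
  rewrite /b -scaleN1r -mul_mpolyC; apply: freeofM; first exact: freeofC.
  apply: big_ind => [|x y|i ik]; first by rewrite -mpolyC0; exact: freeofC.
    exact: freeofD.
  rewrite -mul_mpolyC expr2; apply: freeofM; first exact: freeofC.
  by apply: freeofM; apply: freeofX.
pose red p := exists A B Q,
  [/\ freeof k A, freeof k B & p = A + B * 'X_k + Q * P].
have f0 : freeof k 0 by rewrite -mpolyC0; exact: freeofC.
have redD x y : red x -> red y -> red (x + y).
  move=> [A [B [Q [fA fB ->]]]] [C [D [Q' [fC fD ->]]]].
  exists (A + C), (B + D), (Q + Q'); split; try exact: freeofD.
  by ring.
have redM x y : red x -> red y -> red (x * y).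
  move=> [A [B [Q [fA fB ->]]]] [C [D [Q' [fC fD ->]]]].
  exists (A * C + b * (B * D)), (A * D + B * C),
    (Q * (C + D * 'X_k + Q' * P) + (A + B * 'X_k) * Q'
      + B * D * ((a k)^-1)%:MP).
  split; try by [apply: freeofD; do ?apply: freeofM].
  apply/eqP; rewrite -subr_eq0; apply/eqP.
  transitivity (B * D * ('X_k ^+ 2 - (b + ((a k)^-1)%:MP * P))); first by ring.
  by rewrite XkE subrr mulr0.
have redC c : red c%:MP.
  exists c%:MP, 0, 0; split=> //; first exact: freeofC.
  by rewrite !mul0r !addr0.
have redX i : red 'X_i.
  have [->|ik] := eqVneq i k.
    exists 0, 1, 0; split=> //; first exact: freeofC.
    by rewrite mul1r mul0r addr0 add0r.
  exists 'X_i, 0, 0; split=> //; first exact: freeofX.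
  by rewrite !mul0r !addr0.
have redA x : red x.
  rewrite [x]mpolyE; apply: big_ind => //; first by rewrite -mpolyC0; exact: redC.
  move=> m _; rewrite -mul_mpolyC; apply: (redM); first exact: redC.
  rewrite mpolyXE_id; apply: big_ind => [||i _]; [exact: redC|exact: redM|].
  elim: (m _) => [|n ih]; first exact: redC.
  by rewrite exprS; apply: redM.
have nored A B Q : freeof k A -> freeof k B -> A + B * 'X_k = Q * P -> A = 0 /\ B = 0.
  move=> fA fB e.
  have low m : m \in msupp (A + B * 'X_k) -> (m k <= 1)%N.
    move=> /msuppD_le; rewrite mem_cat => /orP[/fA->//|].
    move=> /msuppM_le /allpairsP[[m1 m2] /= [/fB h1]].
    rewrite msuppX inE => /eqP-> ->.
    by rewrite mnmDE h1 mnmE eqxx.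
  have Q0 : Q = 0.
    apply/eqP/negP=> /negP Q0.
    have QP0 : Q * P != 0 by rewrite mulf_neq0 ?diag_neq0.
    have := low (mlead (Q * P)).
    rewrite e mlead_supp // => /(_ isT).
    by rewrite mleadM ?diag_neq0 // leadP !mnmDE !mnmE eqxx addnC.
  move: e; rewrite Q0 mul0r => e.
  have B0 : B = 0.
    apply/mpolyP=> m; rewrite mcoeff0.
    have [mk|mk] := eqVneq (m k) 0%N; last first.
      by apply: memN_msupp_eq0; apply/negP=> /fB mk0; rewrite mk0 in mk.
    have := congr1 (mcoeff (U_(k) + m)) e.
    rewrite mcoeff0 mcoeffD mcoeffMX memN_msupp_eq0 ?add0r //.
    apply/negP=> /fA; rewrite mnmDE mnmE eqxx mk => //.
  by split=> //; move: e; rewrite B0 mul0r addr0.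
move=> [R pqE].
have [A [B [Q [fA fB pE]]]] := redA p.
have [C [D [Q' [fC fD qE]]]] := redA q.
have [h1 h2] : A * C + b * (B * D) = 0 /\ A * D + B * C = 0.
  apply: (nored _ _ (R - (Q * (C + D * 'X_k + Q' * P) + (A + B * 'X_k) * Q'
      + B * D * ((a k)^-1)%:MP))).
  - by apply: freeofD; do ?apply: freeofM.
  - by apply: freeofD; do ?apply: freeofM.
  apply/eqP; rewrite mulrBl -pqE pE qE -subr_eq0; apply/eqP.
  transitivity (- (B * D * ('X_k ^+ 2 - (b + ((a k)^-1)%:MP * P)))); first by ring.
  by rewrite XkE subrr mulr0 oppr0.
have AB : A ^+ 2 - b * B ^+ 2 = 0 -> A = 0 /\ B = 0.
  move=> h.
  have [j jk] := ord_neq k.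
  pose f i := if i == k then A else 'X_i * B.
  have f0' : forall i, f i = 0.
    apply: mpoly_aniso; rewrite (bigD1 k) //= [f k]/f eqxx.
    have -> : \sum_(i | i != k) a i *: f i ^+ 2 = a k *: (- b * B ^+ 2).
      rewrite /b opprK mulr_suml scaler_sumr; apply: eq_bigr => i /negPf ik.
      by rewrite /f ik exprMn -scalerAl scalerA [a k * _]mulrC divfK.
    by rewrite -scalerDr mulNr h scaler0.
  have A0 : A = 0 by have := f0' k; rewrite /f eqxx.
  split=> //; have /eqP := f0' j; rewrite /f (negPf jk) mulf_eq0.
  case/orP=> [|/eqP//]; rewrite -msupp_eq0 msuppX //.
have : (A ^+ 2 - b * B ^+ 2) * D = 0.
  transitivity (A * (A * D + B * C) - B * (A * C + b * (B * D))); first by ring.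
  by rewrite h1 h2 !mulr0 subrr.
move/eqP; rewrite mulf_eq0 => /orP[/eqP/AB[A0 B0]|/eqP D0].
  by left; exists Q; rewrite pE A0 B0 mul0r !add0r.
move: h1 h2; rewrite D0 !mulr0 addr0 add0r => /eqP h1 /eqP h2.
have [C0|C0] := eqVneq C 0.
  by right; exists Q'; rewrite qE C0 D0 mul0r !add0r.
left; exists Q; move: h1 h2; rewrite !mulf_eq0 (negPf C0) !orbF.
by move=> /eqP A0 /eqP B0; rewrite pE A0 B0 mul0r !add0r.
Qed.

End DiagonalPrime.

Section QuasilinearForms.
Variables (F : fieldType) (V : vectType F).

(* The polar form of such a map is zero, so these are exactly the quadratic forms
   with phi (v + w) = phi v + phi w. *)
Record qlform := QLForm {
  qlform_fun :> V -> F;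
  qlformZ : forall (c : F) (v : V), qlform_fun (c *: v) = c ^+ 2 * qlform_fun v;
  qlformD : forall v w : V, qlform_fun (v + w) = qlform_fun v + qlform_fun w }.

Definition isotropic (phi : qlform) := exists v : V, v != 0 /\ phi v = 0.

Definition anisotropic (phi : qlform) := ~ isotropic phi.

Variable phi : qlform.

Lemma qlform0 : phi 0 = 0.
Proof. by rewrite -(scale0r 0) qlformZ expr0n mul0r. Qed.

Lemma qlform_sum (I : Type) (r : seq I) (P : pred I) (f : I -> V) :
  phi (\sum_(i <- r | P i) f i) = \sum_(i <- r | P i) phi (f i).
Proof. exact: (big_morph phi (qlformD phi) qlform0). Qed.

Lemma qlform_mul2 v : phi v *+ 2 = 0.
Proof.
have : phi (2%:R *: v) = phi v *+ 2 by rewrite scaler_nat mulr2n qlformD.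
rewrite qlformZ -natrX mulr_natl => /eqP.
by rewrite -subr_eq0 -mulrnBr // => /eqP.
Qed.

Lemma defect_exists :
  exists U : {vspace V}, forall v, (v \in U) = (phi v == 0).
Proof.
pose sub n := `[< exists U : {vspace V},
  \dim U = n /\ forall v, v \in U -> phi v = 0 >].
have ex0 : exists n, sub n.
  exists 0%N; apply/asboolP; exists 0%VS; rewrite dimv0; split=> // v.
  by rewrite memv0 => /eqP->; exact: qlform0.
have ub n : sub n -> (n <= \dim {:V})%N.
  by move=> /asboolP[U [<- _]]; apply/dimvS/subvf.
have [n /asboolP[U [dU hU]] nmax] := ex_maxnP ex0 ub.
exists U => v; apply/idP/eqP => [/hU//|v0].
have : sub (\dim (U + <[v]>)).
  apply/asboolP; exists (U + <[v]>)%VS; split=> //.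
  move=> _ /memv_addP[u uU [_ /vlineP[c ->] ->]].
  by rewrite qlformD (hU _ uU) qlformZ v0 mulr0 addr0.
move=> /nmax; rewrite -dU => le.
have /eqP -> : U == (U + <[v]>)%VS by rewrite eqEdim addvSl.
exact: (subvP (addvSr U <[v]>)) _ (memv_line v).
Qed.

Definition defect_space : {vspace V} := projT1 (cid defect_exists).

Lemma defect_spaceP v : (v \in defect_space) = (phi v == 0).
Proof. by rewrite /defect_space; case: cid. Qed.

Definition i0 : nat := \dim defect_space.

End QuasilinearForms.

Section ScalarExtension.
Variables (F : fieldType) (V : vectType F) (phi : qlform V).
Variables (L : fieldType) (iota : {rmorphism F -> L}).

(* V (x)_F L is identified with L^(dim V) by means of the basis vbasis {:V}. *)
Definition scalar_ext_fun (x : 'rV[L]_(\dim {:V})) : L :=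
  \sum_(i < \dim {:V}) iota (phi (vbasis {:V})`_i) * x 0 i ^+ 2.

Lemma scalar_ext_funZ (c : L) x :
  scalar_ext_fun (c *: x) = c ^+ 2 * scalar_ext_fun x.
Proof.
rewrite /scalar_ext_fun mulr_sumr; apply: eq_bigr => i _.
by rewrite mxE exprMn mulrCA.
Qed.

Lemma scalar_ext_funD x y :
  scalar_ext_fun (x + y) = scalar_ext_fun x + scalar_ext_fun y.
Proof.
rewrite /scalar_ext_fun -big_split; apply: eq_bigr => i _ /=.
rewrite mxE sqrrD addrAC mulrDr mulrDr mulrnAr -mulrnAl -rmorphMn.
by rewrite qlform_mul2 rmorph0 mul0r addr0.
Qed.

Definition scalar_ext : qlform ('rV[L]_(\dim {:V})) :=
  QLForm scalar_ext_funZ scalar_ext_funD.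

Lemma scalar_extE v :
  scalar_ext (\row_i iota (coord (vbasis {:V}) i v)) = iota (phi v).
Proof.
rewrite {2}(coord_vbasis (memvf v)) qlform_sum rmorph_sum /=.
apply: eq_bigr => i _.
by rewrite mxE qlformZ rmorphM rmorphXn mulrC.
Qed.

End ScalarExtension.

Section SubField.
Variables (K : fieldType) (S : divringClosed K).

Record subfield_of := SubfieldOf { subfield_val : K; _ : subfield_val \in S }.

HB.instance Definition _ := [isSub for subfield_val].
HB.instance Definition _ := [Choice of subfield_of by <:].
HB.instance Definition _ :=
  [SubChoice_isSubIntegralDomain of subfield_of by <:].
HB.instance Definition _ := [SubIntegralDomain_isSubField of subfield_of by <:].

Variables (F : fieldType) (f : {rmorphism F -> K}).
Hypothesis fS : forall c, f c \in S.

Definition subfield_lift (c : F) : subfield_of := SubfieldOf (fS c).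

Lemma subfield_lift_is_zmod_morphism : zmod_morphism subfield_lift.
Proof. by move=> x y; apply/val_inj; rewrite /= rmorphB. Qed.

Lemma subfield_lift_is_monoid_morphism : monoid_morphism subfield_lift.
Proof. by split=> [|x y]; apply/val_inj; rewrite /= ?rmorph1 ?rmorphM. Qed.

HB.instance Definition _ := GRing.isZmodMorphism.Build F subfield_of
  subfield_lift subfield_lift_is_zmod_morphism.
HB.instance Definition _ := GRing.isMonoidMorphism.Build F subfield_of
  subfield_lift subfield_lift_is_monoid_morphism.

End SubField.

Section HomogeneousFractions.
Variables (F : fieldType) (N : nat) (D : idomainType).
Variable h : {rmorphism {mpoly F[N]} -> D}.

Local Notation "x %:F" := (@FracField.tofrac D x).

Definition deg0_frac : {pred {fraction D}} := fun x =>
  `[< exists d (p q : {mpoly F[N]}),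
      [/\ p \is d.-homog, q \is d.-homog, h q != 0
        & x = (h p)%:F / (h q)%:F] >].

Lemma deg0_frac_divring : divring_closed deg0_frac.
Proof.
split=> [|x y|x y].
- apply/asboolP; exists 0%N, 1, 1; rewrite !rmorph1 oner_eq0 divr1.
  by split=> //; exact: dhomog1.
- move=> /asboolP[d [p [q [hp hq q0 ->]]]] /asboolP[e [r [s [hr hs s0 ->]]]].
  apply/asboolP; exists (d + e)%N, (p * s - r * q), (q * s); split.
  + by apply: rpredB; [|rewrite addnC]; exact: dhomogM.
  + exact: dhomogM.
  + by rewrite rmorphM mulf_neq0.
  + by rewrite -mulNr addf_div ?tofrac_eq0 // !(rmorphB, rmorphM) /= mulNr.
- move=> /asboolP[d [p [q [hp hq q0 ->]]]] /asboolP[e [r [s [hr hs s0 ->]]]].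
  apply/asboolP; have [r0|r0] := eqVneq (h r) 0.
    exists 0%N, 0, 1; rewrite r0 !rmorph0 !mul0r invr0 mulr0 rmorph1 oner_eq0.
    by split=> //; [exact: dhomog0|exact: dhomog1].
  exists (d + e)%N, (p * s), (q * r); split; try exact: dhomogM.
  + by rewrite rmorphM mulf_neq0.
  + by rewrite !rmorphM /= invf_div mulf_div.
Qed.

HB.instance Definition _ := GRing.isDivringClosed.Build _ deg0_frac
  deg0_frac_divring.

(* For h the quotient map of {mpoly F[N]} onto D by a homogeneous prime ideal,
   this is the degree 0 part of the localization of the graded ring D at its
   nonzero homogeneous elements, i.e. the function field of Proj D. *)
Definition hfrac_field : fieldType := subfield_of deg0_frac.

Definition const_frac (c : F) : {fraction D} := (h c%:MP)%:F.

Lemma const_frac_is_zmod_morphism : zmod_morphism const_frac.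
Proof. by move=> x y; rewrite /const_frac !rmorphB. Qed.

Lemma const_frac_is_monoid_morphism : monoid_morphism const_frac.
Proof. by split=> [|x y]; rewrite /const_frac ?rmorph1 ?rmorphM. Qed.

HB.instance Definition _ := GRing.isZmodMorphism.Build F {fraction D}
  const_frac const_frac_is_zmod_morphism.
HB.instance Definition _ := GRing.isMonoidMorphism.Build F {fraction D}
  const_frac const_frac_is_monoid_morphism.

Lemma const_frac_deg0 (c : F) : const_frac c \in deg0_frac.
Proof.
apply/asboolP; exists 0%N, c%:MP, 1; rewrite !rmorph1 oner_eq0 divr1.
split=> //; last exact: dhomog1.
by rewrite -[c%:MP]mulr1 mul_mpolyC; apply: dhomogZ; exact: dhomog1.
Qed.

Definition hfrac_const : {rmorphism F -> hfrac_field} :=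
  subfield_lift const_frac_deg0.

End HomogeneousFractions.

Section FunctionField.
Variables (F : fieldType) (V : vectType F) (phi : qlform V).

(* The equation of X_phi in the homogeneous coordinates given by vbasis {:V}; it
   has no mixed terms since phi is additive. *)
Definition form_poly : {mpoly F[\dim {:V}]} :=
  \sum_(i < \dim {:V}) phi (vbasis {:V})`_i *: 'X_i ^+ 2.

Hypothesis phi_aniso : anisotropic phi.
Hypothesis dim_gt1 : (1 < \dim {:V})%N.

Lemma form_poly_aniso (x : 'I_(\dim {:V}) -> F) :
  \sum_(i < \dim {:V}) phi (vbasis {:V})`_i * x i ^+ 2 = 0 -> forall i, x i = 0.
Proof.
move=> e i.
have v0 : \sum_i x i *: (vbasis {:V})`_i = 0.
  apply/eqP/negP => /negP v0; apply: phi_aniso; exists (\sum_i x i *: (vbasis {:V})`_i).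
  split=> //; rewrite -[RHS]e qlform_sum; apply: eq_bigr => j _.
  by rewrite qlformZ mulrC.
have /freeP := basis_free (vbasisP {:V}); exact.
Qed.

Lemma aniso_two0 : 2%:R = 0 :> F.
Proof.
have i : 'I_(\dim {:V}) by exact: Ordinal dim_gt1.
have /eqP := qlform_mul2 phi (vbasis {:V})`_i.
rewrite -[X in X == 0]mulr_natr mulf_eq0.
by rewrite (negPf (coef_neq0 form_poly_aniso i)) => /eqP.
Qed.

(* The two unused proof arguments let prime_idealr and the field structure below
   be inferred: the ideal (phi) is prime only under these hypotheses. *)
Definition form_ideal of anisotropic phi & (1 < \dim {:V})%N :
    {mpoly F[\dim {:V}]} -> bool :=
  fun p => `[< exists q, p = q * form_poly >].

Lemma form_ideal_idealr : idealr_closed (form_ideal phi_aniso dim_gt1).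
Proof.
split; rewrite ?unfold_in.
- by apply/asboolP; exists 0; rewrite mul0r.
- apply/asboolP => -[q /(congr1 (meval (fun=> 0)))/eqP].
  rewrite meval1 mevalM [X in _ * X]raddf_sum /= big1 ?mulr0 ?oner_eq0 // => i _.
  by rewrite mevalZ rmorphXn /= mevalXU expr0n mulr0.
- move=> c p q /asboolP[p' ->] /asboolP[q' ->]; apply/asboolP.
  by exists (c * p' + q'); ring.
Qed.

Lemma form_ideal_prime : prime_idealr_closed (form_ideal phi_aniso dim_gt1).
Proof.
move=> p q /asboolP/(diag_prime form_poly_aniso dim_gt1 aniso_two0) h.
by apply/orP; case: h => h; [left|right]; apply/asboolP.
Qed.

HB.instance Definition _ := isIdealr.Build _
  (form_ideal phi_aniso dim_gt1) form_ideal_idealr.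
HB.instance Definition _ := isPrimeIdealrClosed.Build _
  (form_ideal phi_aniso dim_gt1) form_ideal_prime.

Definition form_prime_ideal : prime_idealr {mpoly F[\dim {:V}]} :=
  form_ideal phi_aniso dim_gt1.

(* The homogeneous coordinate ring F[X_1, .., X_N] / (phi) of X_phi. *)
Definition hcoord_ring := {ideal_quot form_prime_ideal}.

HB.instance Definition _ := GRing.ComNzRing.on hcoord_ring.

Definition hcoord_unit : {pred hcoord_ring} := fun x => `[< exists y, y * x = 1 >].

Definition hcoord_inv (x : hcoord_ring) : hcoord_ring :=
  if pselect (exists y, y * x = 1) is left h then projT1 (cid h) else x.

Lemma hcoord_mulVx : {in hcoord_unit, left_inverse 1 hcoord_inv *%R}.
Proof.
move=> x /asboolP ux; rewrite /hcoord_inv; case: pselect => // h.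
by case: cid.
Qed.

Lemma hcoord_unitPl x y : y * x = 1 -> hcoord_unit x.
Proof. by move=> yx; apply/asboolP; exists y. Qed.

Lemma hcoord_inv_out : {in [predC hcoord_unit], hcoord_inv =1 id}.
Proof.
by move=> x /asboolPn ux; rewrite /hcoord_inv; case: pselect.
Qed.

HB.instance Definition _ := GRing.ComNzRing_hasMulInverse.Build hcoord_ring
  hcoord_mulVx hcoord_unitPl hcoord_inv_out.

HB.instance Definition _ := GRing.ComUnitRing_isIntegral.Build hcoord_ring
  (@Quotient.rquot_IdomainAxiom _ form_prime_ideal).

Definition hcoord (p : {mpoly F[\dim {:V}]}) : hcoord_ring :=
  \pi_({ideal_quot form_prime_ideal})%qT p.

Lemma hcoord_is_zmod_morphism : zmod_morphism hcoord.
Proof. exact: pi_is_zmod_morphism. Qed.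

Lemma hcoord_is_monoid_morphism : monoid_morphism hcoord.
Proof. exact: pi_is_monoid_morphism. Qed.

HB.instance Definition _ :=
  GRing.isZmodMorphism.Build _ _ hcoord hcoord_is_zmod_morphism.
HB.instance Definition _ :=
  GRing.isMonoidMorphism.Build _ _ hcoord hcoord_is_monoid_morphism.

Lemma hcoord_surj x : exists p, hcoord p = x.
Proof. by exists (repr x); rewrite /hcoord reprK. Qed.

Lemma hcoord_eq0 p : hcoord p = 0 <-> exists q, p = q * form_poly.
Proof.
have -> : (hcoord p = 0) <-> (hcoord p == hcoord 0).
  by rewrite rmorph0; split=> /eqP.
rewrite /hcoord -Quotient.idealrBE subr0.
by split=> [/asboolP|h]; last exact/asboolP.
Qed.

Definition function_field : fieldType := hfrac_field hcoord.

Definition ff_const : {rmorphism F -> function_field} :=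
  hfrac_const hcoord.

Definition i1 : nat := i0 (scalar_ext phi ff_const).

End FunctionField.

(* Main.v *)
(* Over a field F of characteristic 2, let A be F with F acting through x
   |-> x ^ 2. A quasilinear form is just an F-linear map V -> A; let U be
   the image of phi, a subspace of the field A, all of whose squares are
   scalars. A generic point of phi = 0 is a ratio g' / g of generic elements
   of U, whence the bound: if g H and g' H are independent for some g, g' in
   U and a subspace H of U, then i1 phi <= dim U - dim H. By semicontinuity,
   g, g' and H may be sought over any extension L of F, inside the possibly
   non-reduced algebra A_L.

   Suppose i0 phi_L = j < m. Let J be the kernel of U_L -> R, where R is the
   residue field of A_L, and W its image, so dim W > 2 ^ n. As long as some
   b in R has b W and W independent, replace L by L(sqrt b): this halves the
   degree of R and changes neither dim J nor dim W. So assume that every b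
   in R is a ratio g' / g of elements of W. The degree of R is a power of 2
   exceeding 2 ^ n, hence at least 2 ^ (n + 1), and a rank argument gives b
   in R with W' and b W' independent, where W' is a subspace of W of
   dimension 2 ^ n. Among the pairs g, g' with g W' and g' W' independent,
   let (u, v) |-> g u + g' v have maximal rank on J. If it kills some (u, v)
   <> 0, then U u + U v lies in its image, of dimension < 2 j; but up to the
   unit g, U u + U v contains (g' W' + g W') v, of dimension 2 ^ (n + 1) >=
   2 j. Hence H = J + W', of dimension 2 ^ n + j, works. *)
Require Import Defs.
From HB Require Import structures.
From mathcomp Require Import all_boot all_order all_algebra.
From mathcomp Require Import mpoly boolp ring zify.

Set Implicit Arguments.
Unset Strict Implicit.
Unset Printing Implicit Defensive.

Import GRing.Theory.
Local Open Scope ring_scope.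

(** * Values of diagonal forms over an extension *)

Section Evaluation.
Variables (F : fieldType) (K : comNzRingType) (f : {rmorphism F -> K}).
Hypothesis K2 : 2 \in [pchar K].

Lemma sqrD2 (x y : K) : (x + y) ^+ 2 = x ^+ 2 + y ^+ 2.
Proof. by rewrite -!(pFrobenius_autE K2) rmorphD. Qed.

Lemma sqr_sum (I : Type) (r : seq I) (P : pred I) (x : I -> K) :
  (\sum_(i <- r | P i) x i) ^+ 2 = \sum_(i <- r | P i) x i ^+ 2.
Proof. by rewrite -(pFrobenius_autE K2) rmorph_sum. Qed.

(* With F acting on itself through squares, this is the linear combination of
   the family e with coefficients x (over K, after base change along f). *)
Definition diag_eval q (e : 'I_q -> F) (x : 'rV[K]_q) : K :=
  \sum_i f (e i) * x 0 i ^+ 2.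

Lemma diag_evalD q (e : 'I_q -> F) x y :
  diag_eval e (x + y) = diag_eval e x + diag_eval e y.
Proof.
by rewrite -big_split; apply: eq_bigr => i _; rewrite mxE sqrD2 mulrDr.
Qed.

Lemma diag_evalZ q (e : 'I_q -> F) c x :
  diag_eval e (c *: x) = c ^+ 2 * diag_eval e x.
Proof.
by rewrite mulr_sumr; apply: eq_bigr => i _; rewrite mxE exprMn mulrCA.
Qed.

Lemma diag_eval0 q (e : 'I_q -> F) : diag_eval e 0 = 0.
Proof. by rewrite -(scale0r 0) diag_evalZ expr0n mul0r. Qed.

Lemma diag_eval_sum q (e : 'I_q -> F) (I : Type) (r : seq I) (P : pred I) x :
  diag_eval e (\sum_(i <- r | P i) x i) = \sum_(i <- r | P i) diag_eval e (x i).
Proof. exact: (big_morph _ (diag_evalD e) (diag_eval0 e)). Qed.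

Lemma diag_evalMl q (e : 'I_q -> F) c x :
  diag_eval (fun i => c * e i) x = f c * diag_eval e x.
Proof. by rewrite mulr_sumr; apply: eq_bigr => i _; rewrite rmorphM mulrA. Qed.

End Evaluation.

Local Notation deval e := (diag_eval idfun e).

Lemma rmorph_diag_eval (F : fieldType) (K K' : comNzRingType)
    (f : {rmorphism F -> K}) (g : {rmorphism K -> K'})
    (f' : {rmorphism F -> K'}) q (e : 'I_q -> F) x :
  (forall c, f' c = g (f c)) ->
  g (diag_eval f e x) = diag_eval f' e (map_mx g x).
Proof.
move=> gf; rewrite rmorph_sum; apply: eq_bigr => i _.
by rewrite rmorphM rmorphXn gf mxE.
Qed.

Lemma diag_eval_mulmx (F : fieldType) (K : comNzRingType)
    (f : {rmorphism F -> K}) (F2 : 2 \in [pchar F]) (K2 : 2 \in [pchar K])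
    p q (e : 'I_q -> F) (b : 'I_p -> F) (A : 'M[F]_(p, q)) x :
  (forall i, b i = deval e (row i A)) ->
  diag_eval f e (x *m map_mx f A) = diag_eval f b x.
Proof.
move=> bE; rewrite mulmx_sum_row diag_eval_sum //; apply: eq_bigr => i _.
rewrite diag_evalZ mulrC; congr (_ * _); rewrite -map_row.
by rewrite -(@rmorph_diag_eval _ _ _ idfun f f) // -bE.
Qed.

Section CharacteristicTwoMatrices.
Variables (K : comNzRingType) (K2 : 2 \in [pchar K]).

Lemma addmx_self2 m n (A : 'M[K]_(m, n)) : A + A = 0.
Proof. by rewrite -mulr2n -scaler_nat (pcharf0 K2) scale0r. Qed.

Lemma addmx_eq0_2 m n (A B : 'M[K]_(m, n)) : A + B = 0 -> B = A.
Proof. by move=> AB; rewrite -[B]add0r -(addmx_self2 A) -addrA AB addr0. Qed.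

Lemma mulmx_sqrD2 n (A B : 'M[K]_n) :
  comm_mx A B -> (A + B) *m (A + B) = A *m A + B *m B.
Proof.
move=> AB; rewrite mulmxDl !mulmxDr -AB addrA -(addrA (A *m A)).
by rewrite addmx_self2 addr0.
Qed.

End CharacteristicTwoMatrices.

(** * Algebras whose elements have scalar squares *)

Section SquareRootAlgebra.
Variables (F : fieldType) (q : nat) (e : 'I_q -> F) (E : 'I_q -> 'M[F]_q).
Hypothesis F2 : 2 \in [pchar F].
Hypothesis e_free : forall x, deval e x = 0 -> x = 0.
Hypothesis E_table : forall s t, e s * e t = deval e (row t (E s)).

Lemma deval_inj x y : deval e x = deval e y -> x = y.
Proof.
move=> xy; apply/subr0_eq/e_free.
rewrite (diag_evalD _ F2) -scaleN1r diag_evalZ.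
by rewrite sqrrN expr1n mul1r xy (addrr_pchar2 F2).
Qed.

Lemma deval_mulE s x : deval e (x *m E s) = e s * deval e x.
Proof.
rewrite -[E s](map_mx_id (fun=> erefl)) (diag_eval_mulmx _ F2 F2 _ (E_table s)).
exact: diag_evalMl.
Qed.

Lemma deval_delta t : deval e (delta_mx 0 t) = e t.
Proof.
rewrite /diag_eval (bigD1 t) //= mxE !eqxx expr1n mulr1.
by rewrite big1 ?addr0 // => i /negPf it; rewrite mxE eqxx it expr0n mulr0.
Qed.

Lemma table_sym s t : row t (E s) = row s (E t).
Proof. by apply: deval_inj; rewrite -!E_table mulrC. Qed.

Lemma table_comm s t : E s *m E t = E t *m E s.
Proof.
apply/row_matrixP => u; apply: deval_inj.
by rewrite !row_mul !deval_mulE !rowE !deval_mulE mulrCA.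
Qed.

Lemma table_sqr s : E s *m E s = (e s)%:M.
Proof.
apply/row_matrixP => u; apply: deval_inj.
rewrite row_mul deval_mulE [row u (E s)]rowE deval_mulE rowE mul_mx_scalar.
by rewrite diag_evalZ mulrA -expr2.
Qed.

Variables (K : comNzRingType) (f : {rmorphism F -> K}).

(* Multiplication by the element with coordinates x in the algebra K (x)_F B,
   where B is the span of the family e and E its multiplication table. *)
Definition mul_mx (x : 'rV[K]_q) : 'M[K]_q := \sum_s x 0 s *: map_mx f (E s).

Lemma pchar2_target : 2 \in [pchar K].
Proof. exact: (rmorph_pchar f). Qed.
Let K2 := pchar2_target.

Lemma mul_mxD x y : mul_mx (x + y) = mul_mx x + mul_mx y.
Proof. by rewrite -big_split; apply: eq_bigr => s _; rewrite mxE scalerDl. Qed.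

Lemma mul_mxZ c x : mul_mx (c *: x) = c *: mul_mx x.
Proof. by rewrite scaler_sumr; apply: eq_bigr => s _; rewrite mxE scalerA. Qed.

Lemma mul_mx0 : mul_mx 0 = 0.
Proof. by rewrite -(scale0r 0) mul_mxZ scale0r. Qed.

Lemma mul_mx_sym x y : x *m mul_mx y = y *m mul_mx x.
Proof.
rewrite !mulmx_sumr; under eq_bigr => s _.
  rewrite -scalemxAr mulmx_sum_row scaler_sumr.
  under eq_bigr do rewrite -map_row table_sym scalerA mulrC -scalerA.
  over.
under [RHS]eq_bigr do rewrite -scalemxAr mulmx_sum_row scaler_sumr.
rewrite exchange_big; apply: eq_bigr => s _; apply: eq_bigr => t _.
by rewrite -map_row.
Qed.

Lemma mul_mx_comm x y : mul_mx x *m mul_mx y = mul_mx y *m mul_mx x.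
Proof.
rewrite mulmx_suml mulmx_sumr; apply: eq_bigr => s _.
rewrite mulmx_sumr mulmx_suml; apply: eq_bigr => t _.
by rewrite -!scalemxAl -!scalemxAr -!map_mxM table_comm !scalerA mulrC.
Qed.

(** Basis elements commute and have scalar squares, and in characteristic 2 squaring is additive on
    commuting matrices. Hence, over a field, an element with nonzero value is invertible. *)
Lemma mul_mx_sqr x : mul_mx x *m mul_mx x = (diag_eval f e x)%:M.
Proof.
rewrite /mul_mx /diag_eval; elim: (index_enum _) => [|s r IHr].
  by rewrite !big_nil mul0mx raddf0.
rewrite !big_cons; set A := \sum_(t <- r) _ in IHr *.
have sA : map_mx f (E s) *m A = A *m map_mx f (E s).
  rewrite mulmx_sumr mulmx_suml; apply: eq_bigr => t _.
  by rewrite -scalemxAl -scalemxAr -!map_mxM table_comm.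
set B := _ *: _; rewrite (mulmx_sqrD2 K2) ?IHr; last first.
  by rewrite /comm_mx -scalemxAl -scalemxAr sA.
rewrite /B -scalemxAl -scalemxAr -map_mxM table_sqr map_scalar_mx.
rewrite !scale_scalar_mx raddfD; congr (_%:M + _).
by rewrite mulrA -expr2 mulrC.
Qed.

(** Evaluation is thus the residue map of the algebra: injective over [F] by [e_free], but possibly
    with a kernel over an extension. *)
Lemma diag_eval_mul x y :
  diag_eval f e (x *m mul_mx y) = diag_eval f e x * diag_eval f e y.
Proof.
rewrite mulmx_sumr (diag_eval_sum _ K2) [RHS]mulr_sumr; apply: eq_bigr => s _.
rewrite -scalemxAr diag_evalZ (diag_eval_mulmx _ F2 K2 _ (E_table s)).
by rewrite diag_evalMl; ring.
Qed.

End SquareRootAlgebra.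

(** * Linear families of matrices over an infinite field *)

(** For a right inverse [C] of [A], the determinant of [(A + t *: B) *m C] is a polynomial in [t]
    with value 1 at 0. *)
Lemma row_free_line (L : fieldType) a b (A B : 'M[L]_(a, b)) :
  row_free A ->
  exists2 p : {poly L}, p != 0 & forall t, p.[t] != 0 -> row_free (A + t *: B).
Proof.
move=> /row_freeP[C AC].
pose p := \det (map_mx polyC (A *m C) + 'X *: map_mx polyC (B *m C)).
have pE t : p.[t] = \det ((A + t *: B) *m C).
  rewrite -[p.[t]]/(horner_eval t p) -det_map_mx; congr (\det _).
  rewrite mulmxDl -scalemxAl; move: (A *m C) (B *m C) => A' B'.
  apply/matrixP => i j; rewrite !mxE rmorphD rmorphM /= /horner_eval.
  by rewrite hornerX !hornerC.
exists p => [|t].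
  apply: contra_neq (oner_neq0 L) => p0.
  by have := pE 0; rewrite p0 horner0 scale0r addr0 AC det1.
rewrite pE => dn0; rewrite -row_leq_rank; apply: leq_trans (mxrankM_maxl _ C).
by rewrite mxrank_unit // unitmxE unitfE.
Qed.

(** This is linearity in one equation: [t = 1] gives additivity, then [x = 0] gives homogeneity. *)
Definition affine_map (L : fieldType) n a b (G : 'rV[L]_n -> 'M[L]_(a, b)) :=
  forall t x y, G (x + t *: y) = G x + t *: G y.

Section InfiniteField.
Variables (F : fieldType) (a0 : F).
Hypothesis a0_inj : injective (GRing.exp a0).
Variables (L : fieldType) (iota : {rmorphism F -> L}).

Lemma nonroot_exists (p : {poly L}) : p != 0 -> exists c, p.[iota c] != 0.
Proof.
move=> p0; pose s := [seq iota (a0 ^+ i) | i <- seq.iota 0 (size p)].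
case: (boolP (all (root p) s)) => [sr|/allPn[_ /mapP[i _ ->] ri]]; last first.
  by exists (a0 ^+ i).
have us : uniq s.
  by rewrite map_inj_uniq ?iota_uniq // => i j /fmorph_inj/a0_inj.
by have := max_poly_roots p0 sr us; rewrite size_map size_iota ltnn.
Qed.

(** Coordinates are moved into the image of [F] one at a time; on each such line only finitely many
    points spoil freeness. *)
Lemma row_free_descent n a b (G : 'rV[L]_n -> 'M[L]_(a, b)) x :
  affine_map G -> row_free (G x) -> exists y, row_free (G (map_mx iota y)).
Proof.
move=> GL.
suff H k : (k <= n)%N -> row_free (G x) -> exists x', row_free (G x') /\
    forall i : 'I_n, (i < k)%N -> exists c, x' 0 i = iota c.
  move=> /(H n (leqnn n))[x' [fx' x'F]].
  have [y yE] := choice (fun i => x'F i (ltn_ord i)).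
  exists (\row_i y i); congr (row_free (G _)): fx'.
  by apply/rowP => i; rewrite !mxE yE.
elim: k => [|k IHk] kn fx; first by exists x.
have [x' [/row_free_line fx' x'F]] := IHk (ltnW kn) fx.
pose k' := Ordinal kn.
have [p p0 pP] := fx' (G (delta_mx 0 k')).
(* Replacing the coordinate by [iota c] means [t = iota c - x' 0 k'], hence the shifted
   polynomial. *)
have [c pc] : exists c, (p \Po ('X - (x' 0 k')%:P)).[iota c] != 0.
  by apply: nonroot_exists; rewrite comp_poly2_eq0 // size_XsubC.
exists (x' + (iota c - x' 0 k') *: delta_mx 0 k'); split.
  by rewrite GL; apply: pP; rewrite horner_comp !hornerE in pc.
move=> i; rewrite ltnS leq_eqVlt => /orP[/eqP ik|ik].
  exists c; have -> : i = k' by apply/val_inj.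
  by rewrite !mxE !eqxx mulr1 addrC subrK.
have [d dE] := x'F i ik; exists d; rewrite !mxE dE.
by rewrite (_ : i == k' = false) ?andbF ?mulr0 ?addr0 //; apply: ltn_eqF.
Qed.

(* A map of maximal rank in a linear family sends no kernel vector out of its
   image under any other member of the family: otherwise moving a little along
   the line joining the two members would increase the rank. *)
Lemma max_rank_kernel n a b c d (Phi : 'rV[L]_n -> 'M[L]_(a, b))
    (G : 'rV[L]_n -> 'M[L]_(c, d)) x :
  affine_map Phi -> affine_map G -> row_free (G x) ->
  exists2 y, row_free (G y) &
    forall (u : 'rV_a) z, u *m Phi y = 0 -> (u *m Phi z <= Phi y)%MS.
Proof.
move=> PhiL GL Gx.
pose P r := `[< exists2 y, row_free (G y) & \rank (Phi y) = r >].
have exP : exists r, P r by exists (\rank (Phi x)); apply/asboolP; exists x.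
have ubP r : P r -> (r <= a)%N by move=> /asboolP[y _ <-]; exact: rank_leq_row.
have [_ /asboolP[y Gy <-] ymax] := ex_maxnP exP ubP.
exists y => // u z uy0; apply: contraT => nsub.
have [K KE] : exists K, row_base (Phi y) = K *m Phi y.
  by apply/submxP; rewrite eq_row_base.
pose w := u *m Phi z.
have fA : row_free (col_mx (row_base (Phi y)) w).
  rewrite -row_leq_rank -addsmxE (adds_eqmx (eq_row_base _) (eqmx_refl _)).
  rewrite addn1 ltn_neqAle mxrankS ?addsmxSl // andbT.
  apply: contra nsub => /eqP eqr.
  apply: submx_trans (addsmxSr (Phi y) w) _.
  have := geq_leqif (mxrank_leqif_eq (addsmxSl (Phi y) w)).
  by rewrite -eqr leqnn => /esym/andP[].
have [p p0 pP] := row_free_line (col_mx (K *m Phi z) 0) fA.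
have [r r0 rP] := row_free_line (G z) Gy.
(* Avoiding the roots of [r] keeps [G] free, avoiding those of [p] keeps the enlarged family
   independent, and [t != 0] allows [w] to be recovered from [u *m Phi (y + t *: z)]. *)
have [t0] : exists t, (p * r * 'X).[iota t] != 0.
  by apply: nonroot_exists; rewrite !mulf_neq0 ?polyX_eq0.
rewrite !hornerM hornerX !mulf_eq0 !negb_or -andbA => /and3P[pt rt tn0].
set t := iota t0 in pt rt tn0.
have : (\rank (Phi (y + t *: z)%R) <= \rank (Phi y))%N.
  by apply: ymax; apply/asboolP; exists (y + t *: z) => //; rewrite GL rP.
rewrite leqNgt => /negP[]; have := pP t pt.
rewrite -row_leq_rank => rk; rewrite -addn1; apply: leq_trans rk _.
apply: mxrankS.
rewrite scale_col_mx scaler0 add_col_mx addr0 KE scalemxAr -mulmxDr -PhiL.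
rewrite -addsmxE addsmx_sub submxMl /=.
have -> : w = t^-1 *: (u *m Phi (y + t *: z)).
  by rewrite PhiL mulmxDr uy0 add0r -scalemxAr scalerA mulVf // scale1r.
exact/scalemx_sub/submxMl.
Qed.

End InfiniteField.

(** * The field generated over the squares *)

(** The span of [e] over the squares is the field generated by [s], built by adjoining one element
    at a time: each is already present or doubles the dimension. The basis consists of products of
    elements of [s], so it inherits the multiplicative property [Q]. *)
Lemma sqrt_algebra_exists (F : fieldType) (F2 : 2 \in [pchar F]) (Q : F -> Prop)
    (Q1 : Q 1) (QM : forall x y, Q x -> Q y -> Q (x * y)) (s : seq F) :
  (forall a, a \in s -> Q a) ->
  exists q (e : 'I_q -> F), [/\ exists d, q = (2 ^ d)%N,
    forall x, deval e x = 0 -> x = 0,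
    forall x y, exists w, deval e x * deval e y = deval e w,
    forall a, a \in s -> exists y, a = deval e y & forall i, Q (e i)].
Proof.
elim: s => [_|a s IHs Qs].
  have dE x : deval (fun _ : 'I_1 => 1) x = x 0 0 ^+ 2 :> F.
    by rewrite /diag_eval big_ord1 mul1r.
  exists 1%N, (fun=> 1); split=> //; first by exists 0%N.
    move=> x; rewrite dE => /eqP; rewrite expf_eq0 /= => /eqP x0.
    by apply/rowP => i; rewrite ord1 mxE.
  by move=> x y; exists (const_mx (x 0 0 * y 0 0)); rewrite !dE mxE exprMn.
have [|q [e [[d qd] e_free e_mul e_s Qe]]] := IHs.
  by move=> b bs; apply: Qs; rewrite inE bs orbT.
case: (pselect (exists y, a = deval e y)) => [ay|nay].
  exists q, e; split=> //; first by exists d.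
  by move=> b; rewrite inE => /orP[/eqP->|/e_s].
pose e' (i : 'I_(q + q)) : F := row_mx (\row_j e j) (\row_j (a * e j)) 0 i.
have e'E x y : deval e' (row_mx x y) = deval e x + a * deval e y.
  rewrite -(diag_evalMl idfun e a) {1}/diag_eval big_split_ord /=.
  congr (_ + _).
    by apply: eq_bigr => i _; rewrite /e' !row_mxEl mxE.
  by apply: eq_bigr => i _; rewrite /e' !row_mxEr mxE.
exists (q + q)%N, e'; split.
- by exists d.+1; rewrite expnS mul2n -addnn qd.
- move=> x; rewrite -[x]hsubmxK e'E.
  move: (lsubmx x) (rsubmx x) => y z yz0.
  have [dz0|dz0] := eqVneq (deval e z) 0.
    move: yz0; rewrite dz0 mulr0 addr0 => /e_free->.
    by rewrite (e_free _ dz0) row_mx0.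
  (* Otherwise [a] would be the quotient of the values of [y] and [z], which lies in the span
     because dividing by a square is a scaling. *)
  have [w wE] := e_mul y z; case: nay; exists ((deval e z)^-1 *: w).
  apply: (mulIf dz0); rewrite diag_evalZ -wE exprVn mulrA -mulrA.
  move/eqP: yz0; rewrite addrC addr_eq0 => /eqP->.
  by rewrite (oppr_pchar2 F2); field.
- move=> x y; rewrite -[x]hsubmxK -[y]hsubmxK !e'E.
  move: (lsubmx x) (rsubmx x) (lsubmx y) (rsubmx y) => x1 x2 y1 y2.
  have [w11 E11] := e_mul x1 y1; have [w22 E22] := e_mul x2 y2.
  have [w12 E12] := e_mul x1 y2; have [w21 E21] := e_mul x2 y1.
  exists (row_mx (w11 + a *: w22) (w12 + w21)); rewrite e'E.
  by rewrite !(diag_evalD _ F2) diag_evalZ -E11 -E22 -E12 -E21; ring.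
- have sub b : (exists y, b = deval e y) -> exists y, b = deval e' y.
    move=> [y ->]; exists (row_mx y 0).
    by rewrite e'E (diag_eval0 _) mulr0 addr0.
  move=> b; rewrite inE => /orP[/eqP->|/e_s/sub//].
  have [y y0] : exists y, deval e y != 0.
    have i : 'I_q by rewrite qd; exists 0%N; rewrite expn_gt0.
    exists (delta_mx 0 i); apply/eqP => /e_free/matrixP/(_ 0 i)/eqP.
    by rewrite !mxE !eqxx oner_eq0.
  have [w wE] := e_mul y y.
  exists (row_mx 0 ((deval e y)^-1 *: w)).
  rewrite e'E (diag_eval0 _) add0r diag_evalZ -wE exprVn -expr2 mulVf ?mulr1 //.
  by rewrite expf_neq0.
- move=> i; rewrite /e'; case: (splitP i) => j ij.
    have -> : i = lshift q j by apply/val_inj.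
    by rewrite row_mxEl mxE.
  have -> : i = rshift q j by apply/val_inj.
  by rewrite row_mxEr mxE; apply: QM => //; apply: Qs; rewrite mem_head.
Qed.

Lemma sqrt_model_exists (F : fieldType) (F2 : 2 \in [pchar F]) (Q : F -> Prop)
    (Q1 : Q 1) (QM : forall x y, Q x -> Q y -> Q (x * y))
    N (a : 'I_N -> F) (Qa : forall l, Q (a l)) :
  exists q (e : 'I_q -> F) E (Y : 'M_(N, q)), [/\ exists d, q = (2 ^ d)%N,
    forall x, deval e x = 0 -> x = 0,
    forall s t, e s * e t = deval e (row t (E s : 'M_q)),
    forall l, a l = deval e (row l Y) & forall i, Q (e i)].
Proof.
have [|q [e [qd e_free e_mul e_a Qe]]] :=
  sqrt_algebra_exists F2 Q1 QM (s := codom a).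
  by move=> _ /codomP[l ->].
have /choice[Y YE] l : exists y, a l = deval e y by apply/e_a/codom_f.
have /choice[w wE] (st : 'I_q * 'I_q) : exists y, e st.1 * e st.2 = deval e y.
  by have [y yE] := e_mul (delta_mx 0 st.1) (delta_mx 0 st.2);
     exists y; rewrite -yE !deval_delta.
exists q, e, (fun s => \matrix_t w (s, t)), (\matrix_l Y l).
by split=> // [s t|l]; rewrite rowK // -wE.
Qed.

(** * Pairs of multiplications *)

Lemma row_free_ker (L : fieldType) a b (A : 'M[L]_(a, b)) :
  (forall u : 'rV_a, u *m A = 0 -> u = 0) -> row_free A.
Proof.
move=> A_inj; rewrite -kermx_eq0; apply/rowV0P => u /sub_kermxP.
exact: A_inj.
Qed.

Lemma row_free_ker0 (L : fieldType) a b (A : 'M[L]_(a, b)) (u : 'rV_a) :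
  row_free A -> u *m A = 0 -> u = 0.
Proof. by move=> A_free uA; apply: (row_free_inj A_free); rewrite mul0mx. Qed.

Lemma row_mx0P (L : comNzRingType) a b (u : 'rV[L]_a) (v : 'rV[L]_b) :
  row_mx u v = 0 -> u = 0 /\ v = 0.
Proof. by move/eqP; rewrite row_mx_eq0 => /andP[/eqP-> /eqP->]. Qed.

(** For a pair of maximal rank, a nonzero kernel vector would put all multiples of some nonzero,
    hence invertible, [v] into the image. The rank would then be [q], at least [p + p], which is
    freeness anyway. *)
Lemma direct_translates (L : fieldType) (L2 : 2 \in [pchar L]) (a0 : L)
    (a0_inj : injective (GRing.exp a0)) q (e : 'I_q -> L) E
    (e_free : forall x, deval e x = 0 -> x = 0)
    (E_table : forall s t, e s * e t = deval e (row t (E s : 'M_q)))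
    p (B : 'M_(p, q)) :
  row_free B -> (p + p <= q)%N ->
  exists x y, row_free (col_mx (B *m mul_mx E idfun x) (B *m mul_mx E idfun y)).
Proof.
move=> B_free pq.
pose Phi (x : 'rV_(q + q)) := col_mx (B *m mul_mx E idfun (lsubmx x))
                                     (B *m mul_mx E idfun (rsubmx x)).
have PhiL : affine_map Phi.
  move=> t x y; rewrite /Phi scale_col_mx add_col_mx !linearD !linearZ /=.
  by rewrite !mul_mxD !mul_mxZ !mulmxDr -!scalemxAr.
(* The empty matrix [G] imposes no side condition on the pair. *)
have [||x _ xP] := max_rank_kernel a0_inj idfun (x := 0) PhiL
  (G := fun _ => 0 : 'M_(0, 0)).
- by move=> t x y; rewrite scaler0 addr0.
- by rewrite -row_leq_rank.
exists (lsubmx x), (rsubmx x); rewrite -/(Phi x); apply/row_free_ker => u ux.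
apply/eqP/negP => /negP u0.
have full (v : 'rV_q) : v != 0 ->
    (forall y, v *m mul_mx E idfun y <= Phi x)%MS -> row_free (Phi x).
  move=> v0 vP; have ev0 : deval e v != 0 by apply: contra_neq v0 => /e_free.
  rewrite -row_leq_rank; apply: leq_trans pq _.
  rewrite -[q in (q <= _)%N](mxrank1 L q); apply/mxrankS/row_subP => i.
  have := vP ((deval e v)^-1 *: (row i 1%:M *m mul_mx E idfun v)).
  rewrite (mul_mx_sym L2 e_free E_table) -scalemxAl -mulmxA.
  rewrite (mul_mx_sqr L2 e_free E_table) mul_mx_scalar scalerA mulVf //.
  by rewrite scale1r.
suff Phi_free : row_free (Phi x).
  by rewrite (row_free_ker0 Phi_free ux) eqxx in u0.
have [ul0|ul0] := eqVneq (lsubmx u) 0; last first.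
  apply: (full (lsubmx u *m B)) => [|y].
    by apply: contra_neq ul0; exact: row_free_ker0.
  have := xP u (row_mx y 0) ux.
  rewrite -{1}[u]hsubmxK mul_row_col row_mxKl row_mxKr mul_mx0.
  by rewrite !mulmx0 addr0 mulmxA.
apply: (full (rsubmx u *m B)) => [|y].
  apply: contra_neq u0 => /(row_free_ker0 B_free) ur0.
  by rewrite -[u]hsubmxK ul0 ur0 row_mx0.
have := xP u (row_mx 0 y) ux.
rewrite -{1}[u]hsubmxK mul_row_col row_mxKl row_mxKr mul_mx0.
by rewrite !mulmx0 add0r mulmxA.
Qed.

(** * Independence of two multiples of a subspace *)

Section PairMatrix.
Variables (F : fieldType) (F2 : 2 \in [pchar F]) (N : nat) (a : 'I_N -> F).
Variables (q : nat) (e : 'I_q -> F) (E : 'I_q -> 'M[F]_q) (Y : 'M[F]_(N, q)).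
Hypothesis e_free : forall x, deval e x = 0 -> x = 0.
Hypothesis E_table : forall s t, e s * e t = deval e (row t (E s)).
Hypothesis YE : forall l, a l = deval e (row l Y).

Section Target.
Variables (K : comNzRingType) (f : {rmorphism F -> K}).
Local Notation mulE := (mul_mx E f).

(* The map (u, v) |-> z u + z' v on pairs from the row space of h. *)
Definition pair_mx r (h : 'M[K]_(r, N)) (z z' : 'rV[K]_N) : 'M[K]_(r + r, q) :=
  col_mx (h *m map_mx f Y *m mulE (z *m map_mx f Y))
         (h *m map_mx f Y *m mulE (z' *m map_mx f Y)).

Lemma diag_eval_model x : diag_eval f e (x *m map_mx f Y) = diag_eval f a x.
Proof. exact: (diag_eval_mulmx f F2 (pchar2_target F2 f) _ YE). Qed.

Lemma diag_eval_pair r (h : 'M_(r, N)) z z' y y' :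
  diag_eval f e (row_mx y y' *m pair_mx h z z') =
  diag_eval f a z * diag_eval f a (y *m h)
    + diag_eval f a z' * diag_eval f a (y' *m h).
Proof.
rewrite mul_row_col (diag_evalD f (pchar2_target F2 f)) !mulmxA.
rewrite !(diag_eval_mul F2 E_table) !diag_eval_model.
by rewrite ![_ * diag_eval f a (_ *m h)]mulrC.
Qed.

Lemma pair_mxD r (h : 'M_(r, N)) t z z' y y' :
  pair_mx h (z + t *: y) (z' + t *: y') = pair_mx h z z' + t *: pair_mx h y y'.
Proof.
rewrite /pair_mx scale_col_mx add_col_mx !mulmxDl -!scalemxAl.
by rewrite !mul_mxD !mul_mxZ !mulmxDr -!scalemxAr.
Qed.

End Target.

Lemma pair_mx_free_idfun r (h : 'M_(r, N)) z z' :
  row_free (pair_mx idfun h z z') <-> forall y y',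
    deval a z * deval a (y *m h) + deval a z' * deval a (y' *m h) = 0 ->
    y = 0 /\ y' = 0.
Proof.
split=> [h_free y y' | h_sep].
  rewrite -(diag_eval_pair idfun) => /e_free/(row_free_ker0 h_free).
  exact: row_mx0P.
apply: row_free_ker => u u0.
move: (diag_eval_pair idfun h z z' (lsubmx u) (rsubmx u)).
rewrite hsubmxK u0 (diag_eval0 idfun) => /esym/h_sep[ul0 ur0].
by rewrite -[u]hsubmxK ul0 ur0 row_mx0.
Qed.

Lemma map_pair_mx (K K' : comNzRingType) (f : {rmorphism F -> K})
    (g : {rmorphism K -> K'}) (f' : {rmorphism F -> K'})
    r (h : 'M_(r, N)) z z' :
  (forall c, f' c = g (f c)) ->
  map_mx g (pair_mx f h z z') =
  pair_mx f' (map_mx g h) (map_mx g z) (map_mx g z').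
Proof.
move=> gf; have gfE m n (A : 'M_(m, n)) : map_mx g (map_mx f A) = map_mx f' A.
  by apply/matrixP => i k; rewrite !mxE gf.
have gm x : map_mx g (mul_mx E f x) = mul_mx E f' (map_mx g x).
  by rewrite raddf_sum; apply: eq_bigr => s _ /=; rewrite map_mxZ mxE gfE.
by rewrite map_col_mx !map_mxM !gm !map_mxM gfE.
Qed.

(** The matrix is linear in [(z, z')] for fixed [h] and linear in [h] for fixed [(z, z')], so the
    descent is applied twice. *)
Lemma pair_mx_descent (a0 : F) (L : fieldType) (iota : {rmorphism F -> L}) r
    (h : 'M_(r, N)) z z' :
  injective (GRing.exp a0) -> row_free (pair_mx iota h z z') ->
  exists (h : 'M_(r, N)) z z', row_free (pair_mx idfun h z z').
Proof.
move=> a0_inj h_free.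
pose G (x : 'rV_(N + N)) := pair_mx iota h (lsubmx x) (rsubmx x).
have [||x x_free] := row_free_descent a0_inj (x := row_mx z z') iota (G := G).
- by move=> t x y; rewrite /G !linearD !linearZ /= pair_mxD.
- by rewrite /G row_mxKl row_mxKr.
pose H (v : 'rV_(r * N)) := pair_mx iota (vec_mx v : 'M_(r, N))
  (map_mx iota (lsubmx x)) (map_mx iota (rsubmx x)).
have [||v v_free] := row_free_descent a0_inj (x := mxvec h) iota (G := H).
- move=> t v w; rewrite /H linearD linearZ /pair_mx scale_col_mx add_col_mx.
  by rewrite !mulmxDl -!scalemxAl.
- by rewrite /H mxvecK !map_lsubmx !map_rsubmx.
exists (vec_mx v), (lsubmx x), (rsubmx x).
by rewrite -(row_free_map iota) (map_pair_mx (f' := iota)) // map_vec_mx.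
Qed.

Section TargetField.
Variables (L : fieldType) (iota : {rmorphism F -> L}).
Local Notation mulE := (mul_mx E iota).
Local Notation YL := (map_mx iota Y).
Local Notation phi := (diag_eval iota a).
Variables (a0 : L) (a0_inj : injective (GRing.exp a0)).

(** Independence of the two multiples of the row space of [h] after passing to the residue field;
    [pair_mx] tests it before reduction. *)
Definition separated p (h : 'M[L]_(p, N)) z z' := forall y y',
  phi z * phi (y *m h) + phi z' * phi (y' *m h) = 0 -> y = 0 /\ y' = 0.

Variables (j p b c : nat) (hJ : 'M[L]_(j, N)) (h : 'M[L]_(p, N)).
Variable G : 'rV[L]_(N + N) -> 'M[L]_(b, c).
Hypothesis Y_free : row_free Y.
Hypothesis hJ_free : row_free hJ.
Hypothesis hJ_iso : forall x, phi (x *m hJ) = 0.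
Hypothesis p_gt0 : (0 < p)%N.
Hypothesis jp : (j <= p)%N.
Hypothesis G_affine : affine_map G.
Hypothesis G_separated : forall x,
  row_free (G x) <-> separated h (lsubmx x) (rsubmx x).

(** The rows of [hJ] span the kernel part J, those of [h] the complement W'. Encoding separation as
    freeness of [G] lets the rank on J be maximized among separated pairs only. *)
Lemma pair_mx_free_exists x0 : row_free (G x0) ->
  exists z z', row_free (pair_mx iota (col_mx hJ h) z z').
Proof.
move=> Gx0; have L2 := pchar2_target F2 iota.
pose Phi (x : 'rV[L]_(N + N)) := pair_mx iota hJ (lsubmx x) (rsubmx x).
have PhiL : affine_map Phi.
  by move=> t x y; rewrite /Phi !linearD !linearZ /= pair_mxD.
have [x /G_separated sep xP] := max_rank_kernel a0_inj idfun PhiL G_affine Gx0.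
have PhiE : Phi x = pair_mx iota hJ (lsubmx x) (rsubmx x) by [].
move: (lsubmx x) (rsubmx x) sep PhiE => z z' sep PhiE.
pose g := z *m YL; pose g' := z' *m YL.
have hJY_free : row_free (hJ *m YL).
  apply: row_free_ker => u; rewrite mulmxA => u0.
  apply/(row_free_ker0 hJ_free)/(row_free_ker0 (A := YL)) => //.
  by rewrite row_free_map.
have evE y : diag_eval iota e (y *m YL) = phi y by apply: diag_eval_model.
have phi_z : phi z != 0.
  have /eqP := oner_neq0 L; apply: contra_not_neq => z0.
  pose i0 := Ordinal p_gt0.
  have [|/rowP/(_ i0)] := sep (delta_mx 0 i0) 0.
    by rewrite z0 mul0r mul0mx (diag_eval0 iota) mulr0 addr0.
  by rewrite !mxE !eqxx.
have Phi_free : row_free (Phi x).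
  apply: contraT => Phi_nfree.
  have rk : (\rank (Phi x) < j + j)%N.
    by rewrite ltnNge; apply: contra Phi_nfree; rewrite row_leq_rank.
  have [u u0 ux] : exists2 u : 'rV_(j + j), u != 0 & u *m Phi x = 0.
    by move: Phi_nfree; rewrite -kermx_eq0 => /rowV0Pn[u /sub_kermxP uK u0];
       exists u.
  pose u1 := lsubmx u *m (hJ *m YL); pose u2 := rsubmx u *m (hJ *m YL).
  have u12 : u2 *m mulE g' = u1 *m mulE g.
    apply: (addmx_eq0_2 L2); move: ux.
    by rewrite PhiE -{1}[u]hsubmxK mul_row_col /u1 /u2 !mulmxA.
  (* If [u2 = 0], then [g] kills [u1]; but [g] is invertible, its square being the nonzero scalar
     [phi z]. *)
  have u2n0 : u2 != 0.
    apply: contra_neq u0 => u20; move: u12; rewrite u20 mul0mx => /esym u10.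
    have /(congr1 (mulmx^~ (mulE g))) := u10.
    rewrite mul0mx -mulmxA (mul_mx_sqr F2 e_free E_table) evE mul_mx_scalar.
    move/eqP; rewrite scaler_eq0 (negPf phi_z) /= => /eqP.
    move=> /(row_free_ker0 hJY_free) ul0.
    by rewrite -[u]hsubmxK ul0 (row_free_ker0 hJY_free u20) row_mx0.
  pose T := col_mx (h *m YL *m mulE (u2 *m mulE g'))
                   (h *m YL *m mulE (u2 *m mulE g)).
  have TE y y' : row_mx y y' *m T =
      u2 *m (mulE g' *m mulE (y *m h *m YL) + mulE g *m mulE (y' *m h *m YL)).
    rewrite mul_row_col !mulmxA !(mul_mx_sym F2 e_free E_table iota (_ *m YL)).
    by rewrite mulmxDr !mulmxA.
  have T_free : row_free T.
    apply: row_free_ker => y; rewrite -[y]hsubmxK TE.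
    move: (lsubmx y) (rsubmx y) => y1 y2.
    set C := _ + _ => C0.
    (* The square of [C] is a scalar; as [C] kills [u2 != 0], this scalar vanishes and separation
       applies. *)
    have CC : C *m C = (phi z * phi (y2 *m h) + phi z' * phi (y1 *m h))%:M.
      have mC x1 x2 : comm_mx (mulE x1) (mulE x2).
        exact: (mul_mx_comm F2 e_free E_table).
      have mCC x1 x2 w1 w2 : comm_mx (mulE x1 *m mulE x2) (mulE w1 *m mulE w2).
        by apply: comm_mxM; apply: comm_mx_sym; apply: comm_mxM.
      have sq x1 x2 : mulE x1 *m mulE x2 *m (mulE x1 *m mulE x2) =
          (diag_eval iota e x1 * diag_eval iota e x2)%:M.
        rewrite mulmxA -(mulmxA (mulE x1)) (mC x2) mulmxA -mulmxA.
        by rewrite !(mul_mx_sqr F2 e_free E_table) -scalar_mxM.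
      by rewrite (mulmx_sqrD2 L2) // !sq !evE -raddfD addrC.
    have /(congr1 (mulmx^~ C)) := C0.
    rewrite mul0mx -mulmxA CC mul_mx_scalar => /eqP.
    rewrite scaler_eq0 (negPf u2n0) orbF => /eqP/sep[-> ->].
    by rewrite row_mx0.
  (* Multiplying the maximality property [xP] by [g] and replacing [g u1] by [g' u2] gives the rows
     of [T]. Their rank [p + p] then contradicts [rk]. *)
  have T_sub : (T <= Phi x *m mulE g)%MS.
    apply/row_subP => i; rewrite rowE -[delta_mx _ _]hsubmxK TE.
    move: (lsubmx _) (rsubmx _) => y y'.
    have := xP u (row_mx (y *m h) (y' *m h)) ux; rewrite /Phi row_mxKl row_mxKr.
    rewrite -{1}[u]hsubmxK mul_row_col !mulmxA -!(mulmxA _ hJ) => /submxMr.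
    move=> /(_ _ (mulE g)); congr submx; rewrite mulmxDl mulmxDr !mulmxA u12.
    by rewrite -!mulmxA !(mul_mx_comm F2 e_free E_table iota (_ *m _) g).
  have := mxrankS T_sub; move: T_free; rewrite /row_free => /eqP->.
  move=> /leq_trans/(_ (mxrankM_maxl _ _)); rewrite leqNgt => /negP[].
  by apply: (leq_trans rk); rewrite leq_add.
exists z, z'; apply: row_free_ker => y; rewrite -[y]hsubmxK.
move: (lsubmx y) (rsubmx y) => y1 y2 y0.
(* Evaluation kills J, so separation first removes the coordinates along [h]; [Phi_free] then
   removes those along [hJ]. *)
have phi_y w : phi (w *m col_mx hJ h) = phi (rsubmx w *m h).
  rewrite -{1}[w]hsubmxK mul_row_col (diag_evalD iota L2) hJ_iso add0r //.
have := diag_eval_pair iota (col_mx hJ h) z z' y1 y2.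
rewrite y0 (diag_eval0 iota) !phi_y => /esym/sep[y1r y2r].
move: y0; rewrite -{1}[y1]hsubmxK -{1}[y2]hsubmxK y1r y2r => y0.
have : row_mx (lsubmx y1) (lsubmx y2) *m Phi x = 0.
  by rewrite -[RHS]y0 PhiE !mul_row_col !mulmxA !mul_row_col !mul0mx !addr0.
move=> /(row_free_ker0 Phi_free).
rewrite -{2}[y1]hsubmxK -{2}[y2]hsubmxK y1r y2r.
by move=> /row_mx0P[-> ->]; rewrite !row_mx0.
Qed.

End TargetField.
End PairMatrix.

(** * Extensions in which every element is a ratio of values *)

Section QuotientsOfValues.
Variables (L : fieldType) (L2 : 2 \in [pchar L]) (N : nat) (a : 'I_N -> L).
Variables (q : nat) (e : 'I_q -> L) (E : 'I_q -> 'M[L]_q) (Y : 'M[L]_(N, q)).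
Hypothesis e_free : forall x, deval e x = 0 -> x = 0.
Hypothesis E_table : forall s t, e s * e t = deval e (row t (E s)).
Hypothesis YE : forall l, a l = deval e (row l Y).
Local Notation phi := (deval a).

Lemma separated_pair_exists (a0 : L) n d k (h : 'M[L]_(2 ^ n + k, N)) :
  injective (GRing.exp a0) -> q = (2 ^ d)%N -> (0 < k)%N ->
  (forall x, phi (x *m h) = 0 -> x = 0) ->
  (forall x, exists z z', phi z != 0 /\ phi z' = deval e x * phi z) ->
  exists z z', row_free (pair_mx E Y idfun (usubmx h) z z').
Proof.
move=> a0_inj qd k0 h_aniso ratio.
have evY x : deval e (x *m map_mx idfun Y) = phi x.
  exact: (diag_eval_model L2 YE idfun).
have hY_free : row_free (h *m map_mx idfun Y).
  apply: row_free_ker => u u0; apply: h_aniso.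
  by rewrite -evY -mulmxA u0 (diag_eval0 idfun).
(* The [2 ^ n + k] independent rows force the power of two [q] above [2 ^ n]. *)
have q_large : (2 ^ n + 2 ^ n <= q)%N.
  have : (2 ^ n < q)%N.
    have := rank_leq_col (h *m map_mx idfun Y).
    move: hY_free; rewrite /row_free => /eqP-> /(leq_trans _); apply.
    by rewrite -[X in (X < _)%N]addn0 ltn_add2l.
  by rewrite qd addnn -mul2n -expnS ltn_exp2l // leq_exp2l.
pose B := usubmx h *m map_mx idfun Y.
have evB u : deval e (u *m B) = phi (u *m usubmx h) by rewrite mulmxA evY.
have B_free : row_free B.
  apply: row_free_ker => u u0.
  have /h_aniso : phi (row_mx u 0 *m h) = 0.
    rewrite -{1}[h]vsubmxK mul_row_col mul0mx addr0.
    by rewrite -evB u0 (diag_eval0 idfun).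
  by move=> /row_mx0P[].
have [x [y xy_free]] :=
  direct_translates L2 a0_inj e_free E_table B_free q_large.
have x0 : deval e x != 0.
  pose i0 : 'I_(2 ^ n) := Ordinal (expn_gt0 2 n).
  apply/eqP => /e_free x0; have := oner_neq0 L; apply/negP; rewrite negbK.
  have : row_mx (delta_mx 0 i0 : 'rV_(2 ^ n)) 0 *m
      col_mx (B *m mul_mx E idfun x) (B *m mul_mx E idfun y) = 0.
    by rewrite x0 mul_row_col mul_mx0 !mulmx0 mul0mx addr0.
  move=> /(row_free_ker0 xy_free)/row_mx0P[].
  by move=> /rowP/(_ i0); rewrite !mxE !eqxx /= => /eqP.
(* Scalars enter through their squares, so this vector has value [deval e y / deval e x]. *)
have [z [z' [z0 z'E]]] := ratio ((deval e x)^-1 *: (x *m mul_mx E idfun y)).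
exists z, z'; apply/(pair_mx_free_idfun L2 e_free E_table YE) => y1 y2.
rewrite z'E diag_evalZ (diag_eval_mul L2 E_table) -!evB => sum0.
suff /(row_free_ker0 xy_free) : row_mx y1 y2 *m
    col_mx (B *m mul_mx E idfun x) (B *m mul_mx E idfun y) = 0.
  exact: row_mx0P.
apply: e_free; rewrite mul_row_col !mulmxA (diag_evalD idfun L2).
rewrite !(diag_eval_mul L2 E_table); apply: (mulfI (invr_neq0 x0)).
apply: (mulfI z0); rewrite !mulr0 -[RHS]sum0.
by rewrite -!(mulmxA _ (usubmx h)) -/B; field.
Qed.

End QuotientsOfValues.

(** * Adjoining a square root *)

Section AdjoinSquareRoot.
Variables (L : fieldType) (L2 : 2 \in [pchar L]) (b : L).

Definition norm_pred : {pred L} :=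
  fun u => `[< exists x y, u = x ^+ 2 + b * y ^+ 2 >].

(** For division, u / w = u w / w^2, and in characteristic 2 the product u w is [(x * x' + b * y *
    y') ^+ 2 + b * (x * y' + y * x') ^+ 2]. *)
Lemma norm_pred_divring : divring_closed norm_pred.
Proof.
split=> [|u v|u v].
- by apply/asboolP; exists 1, 0; rewrite expr0n mulr0 addr0 expr1n.
- move=> /asboolP[x [y ->]] /asboolP[x' [y' ->]]; apply/asboolP.
  exists (x + x'), (y + y'); rewrite !(sqrD2 L2) (oppr_pchar2 L2); ring.
- move=> /asboolP[x [y ->]] /asboolP[x' [y' ->]]; apply/asboolP.
  move wE: (x' ^+ 2 + _) => w; have [->|w0] := eqVneq w 0.
    by exists 0, 0; rewrite invr0 expr0n !mulr0 addr0.
  exists ((x * x' + b * y * y') / w), ((x * y' + y * x') / w).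
  by rewrite !exprMn !exprVn !(sqrD2 L2) -wE; field; rewrite wE.
Qed.

Definition norm_closed : divringClosed L :=
  HB.pack norm_pred (GRing.isDivringClosed.Build L norm_pred norm_pred_divring).

Let K : fieldType := subfield_of norm_closed.

Lemma norm_closed_sqr c : pFrobenius_aut L2 c \in norm_closed.
Proof.
by apply/asboolP; exists c, 0; rewrite expr0n mulr0 addr0 pFrobenius_autE.
Qed.

(* x |-> x ^ 2 identifies L(sqrt b) with the subfield L^2(b) of L. *)
Definition adjoin_sqrt : {rmorphism L -> K} := subfield_lift norm_closed_sqr.

Lemma val_adjoin_sqrt c : val (adjoin_sqrt c) = c ^+ 2.
Proof. exact: pFrobenius_autE. Qed.

Lemma norm_closedE (u : K) : exists x y, val u = x ^+ 2 + b * y ^+ 2.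
Proof. by case: u => u uS; move/asboolP: (uS). Qed.

Lemma norm_closed_ex x y : exists u : K, val u = x ^+ 2 + b * y ^+ 2.
Proof.
have uS : x ^+ 2 + b * y ^+ 2 \in norm_closed by apply/asboolP; exists x, y.
by exists (SubfieldOf uS).
Qed.

Lemma norm_row_coords p (w : 'rV[K]_p) :
  exists x y : 'rV_p, forall i, val (w 0 i) = x 0 i ^+ 2 + b * y 0 i ^+ 2.
Proof.
have /choice[xy xyE] i : exists xy : L * L,
    val (w 0 i) = xy.1 ^+ 2 + b * xy.2 ^+ 2.
  by have [x [y]] := norm_closedE (w 0 i); exists (x, y).
by exists (\row_i (xy i).1), (\row_i (xy i).2) => i; rewrite !mxE xyE.
Qed.

(** An entry [x ^+ 2 + b * y ^+ 2] of [w] stands for x + y sqrt(b). The form takes the value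
    [phi (x *m h) + b * phi (y *m h)] there, and the identification with a subfield of [L] squares
    it. *)
Lemma val_diag_eval_adjoin (N : nat) (F : fieldType) (iota : {rmorphism F -> L})
    (f : {rmorphism F -> K}) (fE : forall c, f c = adjoin_sqrt (iota c))
    (a : 'I_N -> F) p (h : 'M[L]_(p, N)) (w : 'rV[K]_p) (x y : 'rV[L]_p) :
  (forall i, val (w 0 i) = x 0 i ^+ 2 + b * y 0 i ^+ 2) ->
  val (diag_eval f a (w *m map_mx adjoin_sqrt h)) =
  (diag_eval iota a (x *m h) + b * diag_eval iota a (y *m h)) ^+ 2.
Proof.
move=> wE.
have [v vE] : exists v : {rmorphism K -> L}, forall u, v u = val u.
  by exists val.
have vs c : v (adjoin_sqrt c) = c ^+ 2 by rewrite vE val_adjoin_sqrt.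
rewrite -vE rmorph_sum mulr_sumr -big_split (sqr_sum L2).
apply: eq_bigr => l _ /=.
rewrite fE rmorphM rmorphXn vs [b * _]mulrCA -mulrDr exprMn.
congr (_ * _ ^+ 2); rewrite !mxE !(sqr_sum L2) mulr_sumr -big_split rmorph_sum.
apply: eq_bigr => i _ /=; rewrite rmorphM mxE vs vE wE !exprMn mulrDl.
by rewrite -mulrA.
Qed.

End AdjoinSquareRoot.

Lemma inj_exp_rmorph (F L : fieldType) (f : {rmorphism F -> L}) (a0 : F) :
  injective (GRing.exp a0) -> injective (GRing.exp (f a0)).
Proof. by move=> a0_inj i j; rewrite -!rmorphXn => /fmorph_inj/a0_inj. Qed.

(** * Induction on the degree of the residue field *)

Section Extensions.
Variables (F : fieldType) (F2 : 2 \in [pchar F]) (N : nat) (a : 'I_N -> F).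
Variables (q : nat) (e : 'I_q -> F) (E : 'I_q -> 'M[F]_q) (Y : 'M[F]_(N, q)).
Hypothesis e_free : forall x, deval e x = 0 -> x = 0.
Hypothesis E_table : forall s t, e s * e t = deval e (row t (E s)).
Hypothesis YE : forall l, a l = deval e (row l Y).
Hypothesis Y_free : row_free Y.
Variables (a0 : F) (a0_inj : injective (GRing.exp a0)).
Variables (n j k : nat).
Hypotheses (jn : (j <= 2 ^ n)%N) (k_gt0 : (0 < k)%N).

(** Induction on the degree [r] of the residue field over [L]: the model over [F] is fixed while [L]
    grows. *)
Lemma pair_mx_free_of_extension (L : fieldType) (iota : {rmorphism F -> L})
    (hJ : 'M_(j, N)) (h : 'M_(2 ^ n + k, N)) :
  row_free hJ -> (forall x, diag_eval iota a (x *m hJ) = 0) ->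
  (forall x, diag_eval iota a (x *m h) = 0 -> x = 0) ->
  exists (h' : 'M_(j + 2 ^ n, N)) z z', row_free (pair_mx E Y idfun h' z z').
Proof.
have L2 := pchar2_target F2 iota.
have [r [e' [E' [Y' [rd e'_free E'_table Y'E _]]]]] := sqrt_model_exists L2
  (Q := fun=> True) I (fun _ _ _ _ => I) (a := fun l => iota (a l)) (fun=> I).
have [m] := ubnP r.
elim: m => // m IHm in L iota L2 r e' E' Y' rd e'_free E'_table Y'E hJ h *.
move=> rm hJ_free hJ_iso h_aniso.
pose phi := diag_eval iota a.
have [d rE] := rd.
have La0_inj := inj_exp_rmorph (f := iota) a0_inj.
case: (pselect (forall x, exists z z',
    phi z != 0 /\ phi z' = deval e' x * phi z)) => [ratio|].
  have [z [z' zz']] := separated_pair_exists L2 e'_free E'_table Y'E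
    La0_inj rE k_gt0 h_aniso ratio.
  pose G (x : 'rV_(N + N)) :=
    pair_mx E' Y' idfun (usubmx h) (lsubmx x) (rsubmx x).
  have [h' [z1 [z1' free1]]] : exists (h' : 'M_(j + 2 ^ n, N)) z1 z1',
      row_free (pair_mx E Y iota h' z1 z1').
    exists (col_mx hJ (usubmx h)).
    apply: (pair_mx_free_exists F2 e_free E_table YE La0_inj (G := G)
      Y_free hJ_free hJ_iso _ jn _ _ (x0 := row_mx z z')).
    - by rewrite expn_gt0.
    - by move=> t x y; rewrite /G !linearD !linearZ /= pair_mxD.
    - move=> x; exact: (pair_mx_free_idfun L2 e'_free E'_table Y'E).
    - by rewrite /G row_mxKl row_mxKr.
  exact: (pair_mx_descent a0_inj free1).
move=> /existsNP[x0 /forallNP no_ratio]; pose b := deval e' x0.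
have phi_ratio z z' : phi z' = b * phi z -> phi z = 0.
  move=> zz'; apply/eqP/negP => /negP z0; apply: (no_ratio z); exists z'.
  by split.
(* A square [b = (x / y) ^+ 2] would be the ratio of the values at [(x / y) *: v] and [v], for any
   [v] of nonzero value. *)
have b_nsq x y : x ^+ 2 + b * y ^+ 2 = 0 -> x = 0 /\ y = 0.
  move=> /eqP; rewrite addr_eq0 (oppr_pchar2 L2) => /eqP xy.
  suff y0 : y = 0.
    by move: xy; rewrite y0 expr0n mulr0 => /eqP; rewrite expf_eq0 /= => /eqP.
  apply/eqP/negP => /negP y0; pose u : 'rV[L]_(2 ^ n + k) := const_mx 1.
  have /h_aniso/rowP u0 : phi (u *m h) = 0.
    apply: (phi_ratio _ ((x / y) *: (u *m h))); rewrite /phi diag_evalZ.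
    by rewrite expr_div_n xy mulfK // expf_neq0.
  have i0 : 'I_(2 ^ n + k) by exists 0%N; rewrite addn_gt0 k_gt0 orbT.
  by have /eqP := u0 i0; rewrite !mxE oner_eq0.
pose K : fieldType := subfield_of (norm_closed L2 b).
pose sigma : {rmorphism L -> K} := adjoin_sqrt L2 b.
pose iota' : {rmorphism F -> K} := sigma \o iota.
have K2 := pchar2_target F2 iota'.
have evK p (g : 'M[L]_(p, N)) (w : 'rV[K]_p) (x y : 'rV[L]_p) :
    (forall i, val (w 0 i) = x 0 i ^+ 2 + b * y 0 i ^+ 2) ->
    val (diag_eval iota' a (w *m map_mx sigma g)) =
    (phi (x *m g) + b * phi (y *m g)) ^+ 2.
  exact: val_diag_eval_adjoin.
have ev1 : exists x, 1 = deval e' x.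
  have i0 : 'I_r by rewrite rE; exists 0%N; rewrite expn_gt0.
  have ei0 : e' i0 != 0.
    apply/eqP; rewrite -deval_delta => /e'_free/rowP/(_ i0)/eqP.
    by rewrite !mxE !eqxx oner_eq0.
  exists ((e' i0)^-1 *: row i0 (E' i0)).
  by rewrite diag_evalZ -E'_table exprVn -expr2 mulVf // expf_neq0.
(* [Q] says that [u], seen in [L], is the square of an element of the old residue field. Asking it
   of the new basis allows the degrees to be compared. *)
pose Q (u : K) := exists x, val u = (deval e' x) ^+ 2.
have Q1 : Q 1 by have [x xE] := ev1; exists x; rewrite -xE expr1n.
have QM u v : Q u -> Q v -> Q (u * v).
  move=> [x xE] [y yE]; exists (x *m mul_mx E' idfun y).
  by rewrite (diag_eval_mul L2 E'_table) exprMn -xE -yE.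
have Qa l : Q (iota' (a l)).
  by exists (row l Y'); rewrite -Y'E; exact: val_adjoin_sqrt.
have [r' [e'' [E'' [Y'' [r'd e''_free E''_table Y''E Qe]]]]] :=
  sqrt_model_exists K2 Q1 QM Qa.
have r'_lt : (r' < r)%N.
  have /choice[X XE] := Qe.
  pose B := \matrix_i X i.
  have BE c : deval e' (c *m B) = \sum_i c 0 i ^+ 2 * deval e' (X i).
    rewrite mulmx_sum_row (diag_eval_sum idfun L2); apply: eq_bigr => i _.
    by rewrite rowK diag_evalZ.
  (* The square roots of the new basis elements, together with their multiples by [b], are
     independent over [L]: squaring a relation among them gives one among the [e''] over [K]. Hence
     twice [r'] is at most [r]. *)
  suff /eqP rk : row_free (col_mx B (B *m mul_mx E' idfun x0)).
    have := rank_leq_col (col_mx B (B *m mul_mx E' idfun x0)).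
    rewrite rk; apply: leq_trans; have [d' ->] := r'd.
    by rewrite -[X in (X < _)%N]addn0 ltn_add2l expn_gt0.
  apply: row_free_ker => u; rewrite -[u]hsubmxK mul_row_col.
  move: (lsubmx u) (rsubmx u) => c c' cc'.
  have /choice[w wE] i : exists w : K, val w = c 0 i ^+ 2 + b * c' 0 i ^+ 2.
    exact: norm_closed_ex.
  have : deval e'' (\row_i w i) = 0.
    have [v vE] : exists v : {rmorphism K -> L}, forall u, v u = val u.
      by exists val.
    apply/val_inj; rewrite -!vE rmorph0 rmorph_sum.
    under eq_bigr => i _ do
      rewrite rmorphM rmorphXn mxE !vE wE [val _]XE -exprMn mulrDr.
    rewrite -(sqr_sum L2) big_split /=.
    have : deval e' 0 = 0 :> L := diag_eval0 idfun e'.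
    rewrite -cc' (diag_evalD idfun L2) mulmxA (diag_eval_mul L2 E'_table) !BE.
    rewrite mulr_suml -/b => sum0; apply/eqP; rewrite expf_eq0 /=; apply/eqP.
    rewrite -[RHS]sum0.
    by congr (_ + _); apply: eq_bigr => i _; ring.
  move=> /e''_free/rowP w0.
  have cE i : c 0 i = 0 /\ c' 0 i = 0.
    by apply: b_nsq; rewrite -wE; have := w0 i; rewrite !mxE => ->.
  have -> : c = 0 by apply/rowP => i; rewrite mxE; have [] := cE i.
  have -> : c' = 0 by apply/rowP => i; rewrite mxE; have [] := cE i.
  by rewrite row_mx0.
apply: (IHm K iota' K2 r' e'' E'' Y'' r'd e''_free E''_table Y''E
  (map_mx sigma hJ) (map_mx sigma h)).
- exact: leq_trans r'_lt rm.
- by rewrite row_free_map.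
- move=> w; have [x [y wE]] := norm_row_coords w; apply/val_inj.
  by rewrite (evK _ _ _ _ _ wE) /phi !hJ_iso mulr0 addr0 expr0n.
(* A zero over [K] gives [phi (x *m h) = b * phi (y *m h)], and [b] is not a ratio of values, so
   both sides vanish. *)
- move=> w w0; have [x [y wE]] := norm_row_coords w.
  have /eqP := evK _ h _ _ _ wE; rewrite w0 eq_sym expf_eq0 /=.
  rewrite addr_eq0 (oppr_pchar2 L2) => /eqP xy.
  have y0 := phi_ratio _ _ xy; move: xy; rewrite y0 mulr0 => /h_aniso x0'.
  move/h_aniso: y0 => y0; apply/rowP => i; apply/val_inj.
  by rewrite wE x0' y0 !mxE expr0n mulr0 addr0.
Qed.

End Extensions.

(** * The function field *)

Lemma size2_polyE (R : nzRingType) (p : {poly R}) :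
  (size p <= 2)%N -> p = (p`_0)%:P + (p`_1)%:P * 'X.
Proof.
move=> p2; apply/polyP => -[|[|i]];
  rewrite coefD coefMX !coefC /= ?addr0 ?add0r //.
by rewrite nth_default // (leq_trans p2).
Qed.

Lemma monic_mul_const (R : nzRingType) (d w : {poly R}) c :
  d \is monic -> (1 < size d)%N -> d * w = c%:P -> w = 0.
Proof.
move=> d_monic d_size dw; apply/eqP/negP => /negP w0.
have := congr1 (fun u : {poly R} => size u) dw.
rewrite size_monicM // size_polyC; move: w0; rewrite -size_poly_gt0.
move: d_size; case: (size d) (size w) => [|[|k]] // [|l] // _ _.
by rewrite addSn addnS; case: (_ != 0).
Qed.

(** Modulo the divisor ['X^2] becomes [k' * w]; the remaining constant is a multiple of a monic
    quadratic, hence zero. *)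
Lemma quadratic_multiple (R : comNzRingType) (k k' u v w : R) (W : {poly R}) :
  k * k' = 1 -> u%:P + 'X^2 * v%:P = ('X^2 - (k' * w)%:P) * W ->
  k * u + w * v = 0.
Proof.
move=> kk' uvW; set d := 'X^2 - _ in uvW.
have d_monic : d \is monic by apply: monicXnsubC.
have dW : d * (W - v%:P) = (u + k' * w * v)%:P.
  by rewrite mulrBr -uvW polyCD !polyCM /d polyCM; ring.
have W0 : W - v%:P = 0.
  by apply: (monic_mul_const d_monic _ dW); rewrite size_XnsubC.
move: dW; rewrite W0 mulr0 => /esym/eqP; rewrite polyC_eq0 => /eqP uv.
by rewrite -[RHS](mulr0 k) -uv mulrDr !mulrA kk' mul1r.
Qed.

Section DiagonalIdeal.
Variables (F : fieldType) (F2 : 2 \in [pchar F]) (N : nat) (a : 'I_N -> F).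
Variables (q : nat) (e : 'I_q -> F) (E : 'I_q -> 'M[F]_q) (Y : 'M[F]_(N, q)).
Hypothesis e_free : forall x, deval e x = 0 -> x = 0.
Hypothesis E_table : forall s t, e s * e t = deval e (row t (E s)).
Hypothesis YE : forall l, a l = deval e (row l Y).

Local Notation P := {mpoly F[N]}.
Local Notation C := (@mpolyC N F : {rmorphism F -> P}).
Let X : 'rV[P]_N := \row_l 'X_l.
Let Phi : P := diag_eval C a X.

Lemma diag_eval_mpoly_free (x : 'rV_q) : diag_eval C e x = 0 -> x = 0.
Proof.
move=> x0; apply/rowP => s; rewrite mxE; apply/mpolyP => m; rewrite mcoeff0.
suff /rowP/(_ s) : \row_t (x 0 t)@_m = 0 by rewrite !mxE.
apply: e_free; have := congr1 (mcoeff (m + m)) x0.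
rewrite mcoeff0 raddf_sum => x0'.
rewrite -[RHS]x0'; apply: eq_bigr => t _; rewrite mxE /= mcoeffCM mcoeff_sqr //.
exact: pcharf0.
Qed.

(** Specializing [X] to [z'] turns the determinant of [G] into 1, so [G] is injective over the
    polynomial ring. *)
Lemma pair_mx_generic_ker r (h : 'M[F]_(r, N)) z z' (u : 'rV[P]_(r + r)) :
  row_free (pair_mx E Y idfun h z z') ->
  u *m pair_mx E Y C (map_mx C h) (map_mx C z) X = 0 -> u = 0.
Proof.
move=> /row_freeP[D hD] u0; pose M := pair_mx E Y C (map_mx C h) (map_mx C z) X.
pose G := M *m map_mx C D.
have detG : \det G != 0.
  apply: contra_neq (oner_neq0 F) => /(congr1 (meval (z' 0))).
  rewrite meval0 -det_map_mx map_mxM.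
  have mC m n (A : 'M[F]_(m, n)) : map_mx (meval (z' 0)) (map_mx C A) = A.
    by apply/matrixP => i j; rewrite !mxE mevalC.
  rewrite (map_pair_mx _ _ (f' := idfun)) => [|c]; last by rewrite /= mevalC.
  rewrite !mC; have -> : map_mx (meval (z' 0)) X = z'.
    by apply/rowP => i; rewrite !mxE mevalXU.
  by rewrite hD det1.
have : u *m G *m \adj G = 0 by rewrite mulmxA u0 !mul0mx.
rewrite -mulmxA mul_mx_adj mul_mx_scalar => /eqP.
by rewrite scalemx_eq0 (negPf detG) => /eqP.
Qed.

(** The substitution [Theta] moves the generic point in the direction [z], with a new variable T,
    and takes [Phi] to [c] times the monic quadratic [d]. Modulo [d] the entries of [p] become
    [al + be T], and divisibility by [d] yields a relation that freeness for the generic pair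
    [(z, X)] excludes unless [al = be = 0]. *)
Lemma diag_ideal_mem r (h : 'M[F]_(r, N)) z z' (p : 'rV[P]_r) Q :
  row_free (pair_mx E Y idfun h z z') -> deval a z != 0 ->
  diag_eval C a (p *m map_mx C h) = Q * Phi ->
  forall s, exists Q', p 0 s = Q' * Phi.
Proof.
move=> h_free; set c := deval a z => c0 pQ.
pose PC := polyC : {rmorphism P -> {poly P}}.
pose f2 : {rmorphism F -> {poly P}} := PC \o C.
pose Theta : {rmorphism P -> {poly P}} :=
  mmap f2 (fun l => ('X_l)%:P + (z 0 l)%:MP%:P * 'X).
have P2 := pchar2_target F2 C; have K2 := pchar2_target F2 f2.
have ThetaC k : f2 k = Theta (C k) by rewrite /Theta /= mmapC.
have ThetaX : map_mx Theta X = map_mx PC X + 'X *: map_mx f2 z.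
  apply/rowP => l; rewrite !mxE /Theta /= mmapX mmap1U.
  by rewrite [X in _ + X]mulrC.
have ev0 x : (Theta x).[0] = x.
  rewrite {1}[x]mpolyE rmorph_sum horner_sum [RHS]mpolyE; apply: eq_bigr => m _.
  rewrite /Theta /= mmapZ mmapX hornerM hornerC -mul_mpolyC horner_prod.
  rewrite mpolyXE_id.
  congr (_ * _); apply: eq_bigr => i _.
  by rewrite horner_exp hornerD hornerM hornerX !hornerC mulr0 addr0.
have PCE x : PC x = x%:P by [].
have f2E k : f2 k = PC (C k) by [].
clearbody Theta f2 PC.
pose d : {poly P} := 'X^2 - (c^-1%:MP * Phi)%:P.
have d_monic : d \is monic by apply: monicXnsubC.
have ThetaPhi : Theta Phi = f2 c * d.
  rewrite (rmorph_diag_eval _ _ ThetaC) ThetaX (diag_evalD f2 K2) diag_evalZ.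
  rewrite -(@rmorph_diag_eval _ _ _ C PC f2) //.
  rewrite -(@rmorph_diag_eval _ _ _ idfun f2 f2) //.
  have PhiE : PC Phi = f2 c * (c^-1%:MP * Phi)%:P.
    by rewrite f2E !PCE -polyCM mulrA -mpolyCM divff // mul1r.
  by rewrite PhiE mulrBr addrC mulrC (oppr_pchar2 K2).
pose D s := Pdiv.CommonRing.rdivp (Theta (p 0 s)) d.
pose R s := Pdiv.CommonRing.rmodp (Theta (p 0 s)) d.
have ThetaE s : Theta (p 0 s) = D s * d + R s by apply: Pdiv.RingMonic.rdivp_eq.
have d_size : size d = 3%N by rewrite size_XnsubC.
have RE s : R s = ((R s)`_0)%:P + ((R s)`_1)%:P * 'X.
  apply: size2_polyE.
  by rewrite -ltnS -d_size Pdiv.CommonRing.ltn_rmodp monic_neq0.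
clearbody R D.
pose al : 'rV[P]_r := \row_s (R s)`_0; pose be : 'rV[P]_r := \row_s (R s)`_1.
have pE : map_mx Theta p = map_mx PC al + 'X *: map_mx PC be + d *: \row_s D s.
  apply/rowP => s; rewrite !mxE ThetaE {1}RE !PCE addrC.
  by rewrite [_ * d]mulrC [_ * 'X]mulrC.
have al_s s : (R s)`_0 = al 0 s by rewrite mxE.
have be_s s : (R s)`_1 = be 0 s by rewrite mxE.
clearbody al be.
have evPC x : diag_eval f2 a (map_mx PC x) = PC (diag_eval C a x).
  by apply/esym/rmorph_diag_eval.
have fh : map_mx f2 h = map_mx PC (map_mx C h).
  by apply/matrixP => i k; rewrite !mxE f2E.
have [A AE] :=
  ex_intro (fun u => u = diag_eval C a (al *m map_mx C h)) _ erefl.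
have [B BE] :=
  ex_intro (fun u => u = diag_eval C a (be *m map_mx C h)) _ erefl.
have [W WE] : exists W, A%:P + 'X^2 * B%:P = d * W.
  have : Theta (diag_eval C a (p *m map_mx C h)) = Theta Q * (f2 c * d).
    by rewrite pQ -ThetaPhi; exact: rmorphM.
  rewrite (rmorph_diag_eval _ _ ThetaC) map_mxM pE.
  have -> : map_mx Theta (map_mx C h) = map_mx f2 h.
    by apply/matrixP => i k; rewrite !mxE ThetaC.
  rewrite !mulmxDl -!scalemxAl !(diag_evalD f2 K2) !diag_evalZ.
  rewrite {1 2}fh -!map_mxM.
  rewrite !evPC -AE -BE !PCE => AB.
  exists (Theta Q * f2 c - d * diag_eval f2 a ((\row_s D s) *m map_mx f2 h)).
  rewrite mulrBr [d * (d * _)]mulrA -expr2 [d * (_ * f2 c)]mulrC.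
  by rewrite -[_ * f2 c * d]mulrA -AB addrK.
(* This says that [row_mx al be] times the matrix of the pair [(z, X)] has value 0. *)
have AB0 : c%:MP * A + Phi * B = 0.
  have cK : c%:MP * c^-1%:MP = 1 :> P by rewrite -mpolyCM divff.
  exact: quadratic_multiple cK WE.
have u0 : row_mx al be *m pair_mx E Y C (map_mx C h) (map_mx C z) X = 0.
  apply: diag_eval_mpoly_free; rewrite (diag_eval_pair F2 E_table YE).
  have -> : diag_eval C a (map_mx C z) = c%:MP.
    by rewrite -(@rmorph_diag_eval _ _ _ idfun C C).
  by rewrite -AE -BE.
have [al0 be0] := row_mx0P (pair_mx_generic_ker h_free u0).
move=> s; have Rs0 : R s = 0.
  by rewrite RE al_s be_s al0 be0 !mxE polyC0 mul0r addr0.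
(* Setting T = 0 undoes [Theta] and turns divisibility by [d] into divisibility by [Phi]. *)
have dE : c%:MP * d.[0] = Phi.
  by rewrite -[RHS]ev0 ThetaPhi hornerM f2E PCE hornerC.
exists ((D s).[0] * c^-1%:MP).
rewrite -[LHS]ev0 ThetaE Rs0 addr0 hornerM -dE.
by rewrite mulrA -(mulrA (D s).[0]) -mpolyCM mulVf // mulr1.
Qed.

End DiagonalIdeal.

(** * Elements of infinite order and defect spaces in matrix form *)

(** If [c ^+ k = 1] with [k] odd, then [c = c ^+ k.+1] is a square; if [k] is even, injectivity of
    squaring halves [k]. *)
Lemma nonsquare_exp_inj (F : fieldType) (F2 : 2 \in [pchar F]) (c : F) :
  (forall x, c <> x ^+ 2) -> injective (GRing.exp c).
Proof.
move=> c_nsq; have c0 : c != 0.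
  by apply/eqP => c0; apply: (c_nsq 0); rewrite expr0n.
have no_period k : (0 < k)%N -> c ^+ k <> 1.
  have [l] := ubnP k; elim: l k => // l IHl k kl k0.
  have [k2|k2] := boolP (odd k) => ck.
    apply: (c_nsq (c ^+ (k.+1)./2)); rewrite -exprM muln2 even_halfK /= ?k2 //.
    by rewrite exprS ck mulr1.
  apply: (IHl k./2).
  - by move: kl k0; rewrite -{1 2}(even_halfK k2); lia.
  - by move: k0; rewrite -{1}(even_halfK k2) double_gt0.
  apply/eqP; rewrite -subr_eq0; suff : (c ^+ k./2 - 1) ^+ 2 == 0.
    by rewrite expf_eq0.
  rewrite (sqrD2 F2) sqrrN expr1n -exprM muln2 even_halfK // ck.
  by rewrite (addrr_pchar2 F2).
have H i j : (i < j)%N -> c ^+ i <> c ^+ j.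
  move=> ij; rewrite -(subnKC (ltnW ij)) exprD -[LHS]mulr1.
  move=> /(mulfI (expf_neq0 i c0))/esym; apply: no_period.
  by rewrite subn_gt0.
move=> i j cij; have [ij|ij|//] := ltngtP i j; first by case: (H _ _ ij).
by case: (H _ _ ij).
Qed.

Lemma subspace_mx (L : fieldType) N (U : {vspace 'rV[L]_N}) k :
  (k <= \dim U)%N ->
  exists2 K : 'M_(k, N), row_free K & forall x : 'rV_k, x *m K \in U.
Proof.
move=> kU; pose w := widen_ord kU.
have UE x : x *m \matrix_(i < k) (vbasis U)`_(w i) =
    \sum_(i < k) x 0 i *: (vbasis U)`_(w i).
  by rewrite mulmx_sum_row; apply: eq_bigr => i _; rewrite rowK.
exists (\matrix_i (vbasis U)`_(w i)) => [|x]; last first.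
  rewrite UE; apply: memv_suml => i _; apply/memvZ/vbasis_mem/mem_nth.
  by rewrite size_tuple.
apply: row_free_ker => x; rewrite UE => x0.
pose c (i : 'I_(\dim U)) := if insub (val i) is Some i' then x 0 i' else 0.
have cw i : c (w i) = x 0 i.
  rewrite /c (insubT (fun l => (l < k)%N) (ltn_ord i)) /=.
  by congr (x _ _); exact/val_inj.
have c0 : \sum_(i < \dim U) c i *: (vbasis U)`_i = 0.
  rewrite -[RHS]x0 (bigID (fun i : 'I_(\dim U) => (i < k)%N)) /=.
  rewrite [X in _ + X]big1.
    rewrite addr0; rewrite (big_ord_narrow kU).
    by apply: eq_bigr => i _; rewrite cw.
  by move=> i /negPf ik; rewrite /c insubF // scale0r.
have /freeP/(_ c c0) ci := basis_free (vbasisP U).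
by apply/rowP => i; rewrite mxE -cw ci.
Qed.

Section DefectMatrices.
Variables (L : fieldType) (N : nat) (psi : qlform 'rV[L]_N).

Lemma defect_mx :
  exists2 K : 'M_(i0 psi, N), row_free K & forall x, psi (x *m K) = 0.
Proof.
have [K K_free KU] := subspace_mx (leqnn (\dim (defect_space psi))).
by exists K => // x; apply/eqP; rewrite -defect_spaceP.
Qed.

Lemma aniso_mx k : (k + i0 psi <= N)%N ->
  exists H : 'M_(k, N), forall x, psi (x *m H) = 0 -> x = 0.
Proof.
move=> kN; have [|H H_free HU] := @subspace_mx _ _ (defect_space psi)^C%VS k.
  have dimN : \dim {:'rV[L]_N} = N by rewrite dimvf; exact: mul1n.
  by rewrite dimv_compl dimN leq_subRL 1?addnC // (leq_trans _ kN) ?leq_addl.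
exists H => x /eqP; rewrite -defect_spaceP => xH.
apply: (row_free_ker0 H_free); apply/eqP.
by rewrite -memv0 -(capv_compl (defect_space psi)) memv_cap xH HU.
Qed.

(** An anisotropic subspace meets the defect space trivially. *)
Lemma defect_bound r (H : 'M_(r, N)) :
  (forall x, psi (x *m H) = 0 -> x = 0) -> (i0 psi + r <= N)%N.
Proof.
move=> H_aniso; have [K K_free K_iso] := defect_mx.
suff /eqP <- : row_free (col_mx K H) by exact: rank_leq_col.
apply: row_free_ker => u; rewrite -[u]hsubmxK mul_row_col.
move: (lsubmx u) (rsubmx u) => x y xy0.
have y0 : y = 0.
  by apply: H_aniso; rewrite -[LHS]add0r -(K_iso x) -qlformD xy0 qlform0.
move: xy0; rewrite y0 mul0mx addr0 => /(row_free_ker0 K_free)->.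
by rewrite row_mx0.
Qed.

End DefectMatrices.

(** * Subforms anisotropic over the function field *)

Section FunctionFieldSubforms.
Variables (F : fieldType) (F2 : 2 \in [pchar F]) (V : vectType F).
Variables (phi : qlform V) (phi_aniso : anisotropic phi).
Hypothesis dim_gt1 : (1 < \dim {:V})%N.
Local Notation N := (\dim {:V}).
Let a (l : 'I_N) := phi (vbasis {:V})`_l.
Variables (q : nat) (e : 'I_q -> F) (E : 'I_q -> 'M[F]_q) (Y : 'M[F]_(N, q)).
Hypothesis e_free : forall x, deval e x = 0 -> x = 0.
Hypothesis E_table : forall s t, e s * e t = deval e (row t (E s)).
Hypothesis YE : forall l, a l = deval e (row l Y).

Local Notation ff := (ff_const phi_aniso dim_gt1).
Local Notation hc := (hcoord phi_aniso dim_gt1).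

Lemma form_polyE : form_poly phi = diag_eval (@mpolyC N F) a (\row_l 'X_l).
Proof. by apply: eq_bigr => l _; rewrite mxE mul_mpolyC. Qed.

Lemma function_field_aniso r (h : 'M[F]_(r, N)) z z' x :
  row_free (pair_mx E Y idfun h z z') -> deval a z != 0 ->
  scalar_ext phi ff (x *m map_mx ff h) = 0 -> x = 0.
Proof.
move=> h_free z0 x0.
have [tau tauE] : exists tau : {rmorphism {mpoly F[N]} ->
    {fraction hcoord_ring phi_aniso dim_gt1}},
    forall p, tau p = FracField.tofrac (hc p).
  by exists (@FracField.tofrac _ \o hc).
have tau0 p : tau p = 0 <-> exists Q, p = Q * form_poly phi.
  rewrite -(hcoord_eq0 phi_aniso dim_gt1) tauE.
  by split=> [/eqP|->]; [rewrite tofrac_eq0 => /eqP | exact: rmorph0].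
have [v vE] : exists v : {rmorphism function_field phi_aniso dim_gt1 ->
    {fraction hcoord_ring phi_aniso dim_gt1}}, forall u, v u = val u.
  by exists val.
have vff c : v (ff c) = tau c%:MP by rewrite vE tauE.
have /choice[pq pqE] s : exists pq : {mpoly F[N]} * {mpoly F[N]},
    tau pq.2 != 0 /\ v (x 0 s) = tau pq.1 / tau pq.2.
  rewrite vE; case: (x 0 s) => u uS.
  have /asboolP[d [p [p' [_ _ p'0 uE]]]] := uS.
  by exists (p, p'); rewrite !tauE tofrac_eq0.
clear tauE vE.
(* Clearing denominators turns a zero over the function field into polynomials [n] to which
   [diag_ideal_mem] applies. *)
pose d := \prod_s (pq s).2.
pose n : 'rV_r := \row_s ((pq s).1 * \prod_(t | t != s) (pq t).2).
have d0 : tau d != 0.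
  by rewrite rmorph_prod; apply/prodf_neq0 => s _; have [] := pqE s.
have nE : map_mx tau n = tau d *: map_mx v x.
  apply/rowP => s; have dE : d = (pq s).2 * \prod_(t | t != s) (pq t).2.
    by rewrite /d (bigD1 s).
  rewrite !mxE dE !rmorphM; have [q0 ->] := pqE s.
  by rewrite [RHS]mulrC mulrA mulfVK.
pose C := @mpolyC N F : {rmorphism F -> {mpoly F[N]}}.
pose f3 : {rmorphism F -> {fraction hcoord_ring phi_aniso dim_gt1}} := tau \o C.
have : tau (diag_eval C a (n *m map_mx C h)) = 0.
  rewrite (@rmorph_diag_eval _ _ _ C tau f3) // map_mxM nE -scalemxAl.
  rewrite diag_evalZ.
  have -> : map_mx tau (map_mx C h) = map_mx v (map_mx ff h).
    by apply/matrixP => i l; rewrite !mxE vff.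
  rewrite -map_mxM -(@rmorph_diag_eval _ _ _ ff v f3) => [|c]; last first.
    by rewrite vff.
  by rewrite -[diag_eval ff _ _]/(scalar_ext phi ff _) x0 rmorph0 mulr0.
move=> /tau0[Q]; rewrite form_polyE.
move=> /(diag_ideal_mem F2 e_free E_table YE h_free z0) n_ideal.
apply/rowP => s; rewrite mxE; apply: (fmorph_inj v); rewrite rmorph0.
apply: (mulfI d0); rewrite mulr0; have /rowP/(_ s) := nE; rewrite !mxE => <-.
have [Q' nQ'] := n_ideal s; apply/tau0; exists Q'.
by rewrite form_polyE -nQ' mxE.
Qed.

End FunctionFieldSubforms.

(** * The bound on the first index *)

Lemma i1_bound (F : fieldType) (F2 : 2 \in [pchar F]) (V : vectType F)
    (phi : qlform V) (phi_aniso : anisotropic phi) (dim_gt1 : (1 < \dim {:V})%N)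
    (L : fieldType) (iota : {rmorphism F -> L}) n k
    (j := i0 (scalar_ext phi iota)) :
  (j <= 2 ^ n)%N -> (0 < k)%N -> (2 ^ n + k + j <= \dim {:V})%N ->
  (j + 2 ^ n + i1 phi_aniso dim_gt1 <= \dim {:V})%N.
Proof.
move=> jn k_gt0 kjN.
pose a (l : 'I_(\dim {:V})) := phi (vbasis {:V})`_l.
have a_aniso x : deval a x = 0 -> x = 0.
  by move=> x0; apply/rowP => l; rewrite mxE (form_poly_aniso phi_aniso x0).
(* By anisotropy the ratio of two diagonal coefficients is not a square; its powers supply the
   infinitely many points of [F]. *)
have [c c_nsq] : exists c : F, forall x, c <> x ^+ 2.
  pose l0 : 'I_(\dim {:V}) := Ordinal (ltnW dim_gt1).
  pose l1 : 'I_(\dim {:V}) := Ordinal dim_gt1.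
  have a0 : a l0 != 0.
    apply/eqP => al0.
    have /a_aniso/rowP/(_ l0)/eqP : deval a (delta_mx 0 l0) = 0.
      by rewrite deval_delta.
    by rewrite !mxE !eqxx oner_eq0.
  exists (a l1 / a l0) => x xE.
  have /a_aniso/rowP/(_ l1)/eqP :
      deval a (x *: delta_mx 0 l0 + delta_mx 0 l1) = 0.
    rewrite (diag_evalD idfun F2) diag_evalZ !deval_delta -xE divfK //.
    exact: addrr_pchar2.
  by rewrite !mxE !eqxx mulr0 add0r oner_eq0.
have c_inj := nonsquare_exp_inj F2 c_nsq.
have [q [e [E [Y [_ e_free E_table YE _]]]]] := sqrt_model_exists F2
  (Q := fun=> True) I (fun _ _ _ _ => I) (a := a) (fun=> I).
have Y_free : row_free Y.
  apply: row_free_ker => u u0; apply: a_aniso.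
  rewrite -(diag_eval_model F2 YE idfun) map_mx_id // u0.
  exact: (diag_eval0 idfun).
have [hJ hJ_free hJ_iso] := defect_mx (scalar_ext phi iota).
have [h h_aniso] := aniso_mx kjN.
have [h' [z [z' h'_free]]] := pair_mx_free_of_extension F2 e_free E_table YE
  Y_free c_inj jn k_gt0 hJ_free hJ_iso h_aniso.
have z0 : deval a z != 0.
  have i0 : 'I_(j + 2 ^ n) by exists 0%N; rewrite addn_gt0 expn_gt0 orbT.
  apply/eqP => z0; have [|y0 _] :=
    (pair_mx_free_idfun F2 e_free E_table YE h' z z').1 h'_free
    (delta_mx 0 i0) 0.
    by rewrite z0 mul0r mul0mx (diag_eval0 idfun) mulr0 addr0.
  have /eqP := congr1 (fun u : 'rV_(j + 2 ^ n) => u 0 i0) y0.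
  by rewrite !mxE !eqxx oner_eq0.
rewrite addnC.
apply: (defect_bound (H := map_mx (ff_const phi_aniso dim_gt1) h')) => x.
exact: (function_field_aniso F2 e_free E_table YE h'_free z0).
Qed.

Local Close Scope ring_scope.

Theorem theorem9p2 (F : fieldType) (char2 : 2 \in [pchar F]%R)
    (V : vectType F) (phi : qlform V)
    (phi_aniso : anisotropic phi) (dim_gt1 : 1 < \dim {:V})
    (n m : nat) (dimE : \dim {:V} = 2 ^ n + m) (m_range : 1 <= m <= 2 ^ n)
    (L : fieldType) (iota : {rmorphism F -> L}) :
  i0 (scalar_ext phi iota) < m ->
  i0 (scalar_ext phi iota) + i1 phi_aniso dim_gt1 <= m.
Proof.
move=> jm; have /andP[_ m_le] := m_range.
set j := i0 _ in jm *.
(* With [k = m - j] the required dimension [2 ^ n + k + j] is exactly that of [phi]. *)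
have := @i1_bound F char2 V phi phi_aniso dim_gt1 L iota n (m - j).
rewrite -/j subn_gt0 dimE; lia.
Qed.
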